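(* Let $\aleph$ be an infinite cardinal and $\mathbb K$ a field. The assignments $I\mapsto\mathfrak B(I)$, $f\mapsto\mathfrak B(f)$ and $I\mapsto\mathfrak B^*(I)=\mathfrak B(I)$, $f\mapsto\mathfrak B^*(f)$ define functors $\mathfrak B(-)$ and $\mathfrak B^*(-)$ from $\mathbf{Pos}_\aleph$ to the category $\mathbf{Alg}_{\mathbb K}$, the first covariant and the second contravariant.
   Context: Categories. $\mathbf{Pos}_\aleph$ has as objects all $\aleph$-posets having a finite cofinal subset, and as morphisms $f:I\to J$ all maps that are order imbeddings ($i\le i'$ iff $f(i)\le f(i')$) whose image $f(I)$ is an upper subset of $J$. $\mathbf{Alg}_{\mathbb K}$ has as objects unital $\mathbb K$-algebras and as morphisms not necessarily unital $\mathbb K$-algebra homomorphisms. Conventions. $\aleph$ is an infinite cardinal, regarded as an initial ordinal, so that $\emptyset\in\aleph$; $\mathbb K$ is a field. For a poset $P$, $\mathcal M(P)$ is the set of all maximal chains of $P$ (maximal totally ordered subsets). An $\aleph$-poset is a partially ordered set $I$ with $|I|\le\aleph$ and $|\mathcal M(I)|\le\aleph$. For $i\in I$: $\{i\le\}=\{k\in I: i\le k\}$, $\{\le i\}=\{k\in I:k\le i\}$, $\{i\not\le\}=I\setminus\{i\le\}$, with the induced orders. For a set $A$, $\aleph^{(A)}$ is the set of maps $p:A\to\aleph$ with $p(a)=\emptyset$ for all but finitely many $a\in A$. For a set $X$, $\mathrm{CFM}_X(\mathbb K)$ is the $\mathbb K$-algebra of column-finite $X\times X$ matrices over $\mathbb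 K$, and $\mathrm{FR}_X(\mathbb K)$ is its ideal of matrices with only finitely many nonzero rows; $a(x,y)$ denotes the entry of $a$ in row $x$, column $y$. Construction. Let $X(I)=\aleph^{(I)}\times\mathcal M(I)$ and $Q(I)=\mathrm{CFM}_{X(I)}(\mathbb K)$. For $i\in I$ let $X(i\le)=\aleph^{(\{i\le\})}\times\mathcal M(\{i\le\})$ and let $\psi_{I,i}:\mathrm{CFM}_{X(i\le)}(\mathbb K)\to Q(I)$ be the injective (not necessarily unital) $\mathbb K$-algebra homomorphism given, for $p,q\in\aleph^{(I)}$ and $A,B\in\mathcal M(I)$, by $$\psi_{I,i}(a)((p,A),(q,B))=a\big((p|_{\{i\le\}},A\cap\{i\le\}),(q|_{\{i\le\}},B\cap\{i\le\})\big)$$ if $i\in A\cap B$, $A\cap\{\le i\}=B\cap\{\le i\}$ and $p|_{\{i\not\le\}}=q|_{\{i\not\le\}}$, and $\psi_{I,i}(a)((p,A),(q,B))=0$ otherwise. Put $H(I,i)=\psi_{I,i}(\mathrm{FR}_{X(i\le)}(\mathbb K))$ if $i$ is not a maximal element of $I$, and $H(I,i)=\mathbb K\,\psi_{I,i}(\mathbf 1)$ if $i$ is a maximal element of $I$. For $J\subseteq I$ put $H(I,J)=\sum_{j\in J}H(I,j)\subseteq Q(I)$; this sum is direct and $H(I,J)$ is a (not necessarily unital) $\mathbb K$-subalgebra of $Q(I)$, which is an ideal of $\mathfrak B(I)$ if $J$ is a lower subset of $I$. Finally $\mathfrak B(I)=H(I,I)$, which is a unital subalgebra of $Q(I)$ when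 $I$ has a finite cofinal subset. Action on morphisms. Let $f:I\to J$ be a morphism of $\mathbf{Pos}_\aleph$. For $i\in I$, $f$ restricts to an order isomorphism $\{i\le\}\to\{f(i)\le\}$; let $\tilde f_i:\mathrm{CFM}_{X(i\le)}(\mathbb K)\to\mathrm{CFM}_{X(f(i)\le)}(\mathbb K)$ be the isomorphism $\tilde f_i(a)((u,E),(v,F))=a((u\circ f|_{\{i\le\}},f^{-1}(E)),(v\circ f|_{\{i\le\}},f^{-1}(F)))$ for $u,v\in\aleph^{(\{f(i)\le\})}$, $E,F\in\mathcal M(\{f(i)\le\})$. Let $\hat f_i:H(I,i)\to H(J,f(i))$ be the isomorphism $\psi_{I,i}(a)\mapsto\psi_{J,f(i)}(\tilde f_i(a))$, and $\hat f=\bigoplus_{i\in I}\hat f_i:\mathfrak B(I)\to H(J,f(I))$, a bijective $\mathbb K$-linear map. Then $\mathfrak B(f):\mathfrak B(I)\to\mathfrak B(J)$ is $\hat f$ followed by the inclusion $H(J,f(I))\subseteq\mathfrak B(J)$, and $\mathfrak B^*(f):\mathfrak B(J)\to\mathfrak B(I)$ is the projection $\mathfrak B(J)=H(J,f(I))\oplus H(J,J\setminus f(I))\to H(J,f(I))$ with kernel $H(J,J\setminus f(I))$, followed by $\hat f^{-1}$. *)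

(* Defs.v *)
From HB Require Import structures.
From mathcomp Require Import all_boot all_order all_algebra finmap.
From mathcomp Require Import all_classical.

Set Implicit Arguments.
Unset Strict Implicit.
Unset Printing Implicit Defensive.

Import Order.TTheory GRing.Theory.

Local Open Scope classical_set_scope.
Local Open Scope ring_scope.

(* An infinite cardinal, regarded as an initial ordinal: a well-ordered set
   not equipotent to any of its proper initial segments.  Its least element
   \bot is the ordinal 0, that is, the empty set. *)
Record infinite_cardinal := InfiniteCardinal {
  card_disp : Order.disp_t;
  card_sort :> bOrderType card_disp;
  card_wf : well_founded (fun a b : card_sort => (a < b)%O);
  card_initial : forall a : card_sort,
    ~ ([set b : card_sort | (b < a)%O] #= [set: card_sort])%card;
  card_infinite : infinite_set [set: card_sort]
}.

(* The algType K of the library excludes the zero algebra, which occurs here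
   as the value of the functors at the empty poset. *)
Record unital_algebra (K : fieldType) := UnitalAlgebra {
  ualg_mod :> lmodType K;
  ualg_one : ualg_mod;
  ualg_mul : ualg_mod -> ualg_mod -> ualg_mod;
  ualg_mulA : associative ualg_mul;
  ualg_mul1l : left_id ualg_one ualg_mul;
  ualg_mul1r : right_id ualg_one ualg_mul;
  ualg_linearl : forall b, linear (ualg_mul^~ b);
  ualg_linearr : forall a, linear (ualg_mul a)
}.

Section ColumnFinite.
Variables (K : fieldType) (X : choiceType).

Record cfm := Cfm {
  cfm_entry :> X -> X -> K;
  cfm_colfin : forall y, finite_set [set x | cfm_entry x y != 0]
}.

Lemma cfmP (a b : cfm) : (forall x y, a x y = b x y) -> a = b.
Proof.
case: a b => [a fa] [b fb] /= ab.
have e : a = b by apply/funext => x; apply/funext => y.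
by subst b; congr Cfm; exact: Prop_irrelevance.
Qed.

HB.instance Definition _ := gen_eqMixin cfm.
HB.instance Definition _ := gen_choiceMixin cfm.

Lemma cfm_zero_colfin (y : X) : finite_set [set x : X | (0 : K) != 0].
Proof. by apply: (sub_finite_set _ (finite_set0 X)) => x /=; rewrite eqxx. Qed.

Definition cfm_zero := Cfm cfm_zero_colfin.

Lemma cfm_add_colfin (a b : cfm) y :
  finite_set [set x | a x y + b x y != 0].
Proof.
have fU : finite_set ([set x | a x y != 0] `|` [set x | b x y != 0]).
  by rewrite finite_setU; split; exact: cfm_colfin.
apply: sub_finite_set fU => x /= nz.
have [a0|] := eqVneq (a x y) 0; last by left.
by right; move: nz; rewrite a0 add0r.
Qed.

Definition cfm_add a b := Cfm (cfm_add_colfin a b).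

Lemma cfm_opp_colfin (a : cfm) y : finite_set [set x | - a x y != 0].
Proof. by apply: sub_finite_set (cfm_colfin a y) => x /=; rewrite oppr_eq0. Qed.

Definition cfm_opp a := Cfm (cfm_opp_colfin a).

Lemma cfm_scale_colfin (k : K) (a : cfm) y :
  finite_set [set x | k * a x y != 0].
Proof.
by apply: sub_finite_set (cfm_colfin a y) => x /=; rewrite mulf_eq0 negb_or => /andP[].
Qed.

Definition cfm_scale k a := Cfm (cfm_scale_colfin k a).

Lemma cfm_one_colfin (y : X) : finite_set [set x : X | (x == y)%:R != 0 :> K].
Proof.
apply: (sub_finite_set _ (finite_set1 y)) => x /=.
by have [//|_] := eqVneq x y; rewrite eqxx.
Qed.

Definition cfm_one := Cfm cfm_one_colfin.

Lemma fsum_fset (F : X -> K) (T : {fset X}) :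
  (forall z, F z != 0 -> z \in T) -> \sum_(z \in [set: X]) F z = \sum_(z <- T) F z.
Proof.
by move=> FT; apply: fsbigTE => z zT; apply/eqP; apply: contraNT zT => /FT.
Qed.

Lemma cfm_supp (a : cfm) y : {T : {fset X} | forall x, a x y != 0 -> x \in T}.
Proof.
exists (fset_set [set x | a x y != 0]) => x nz.
by rewrite in_fset_set; [exact/mem_set|exact: cfm_colfin].
Qed.

Lemma cfm_mul_supp (a b : cfm) y :
  {T : {fset X} * {fset X} |
    [/\ forall z, b z y != 0 -> z \in T.1,
        forall z x, z \in T.1 -> a x z != 0 -> x \in T.2 &
        forall x, \sum_(z \in [set: X]) a x z * b z y != 0 -> x \in T.2]}.
Proof.
have [S hS] := cfm_supp b y.
pose U := (\bigcup_(z in [set` S]) [set x | a x z != 0]).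
have fU : finite_set U.
  by apply: bigcup_finite => [|z _]; [exact: finite_fset|exact: cfm_colfin].
have aU z x : z \in S -> a x z != 0 -> x \in fset_set U.
  by move=> zS nz; rewrite in_fset_set //; apply/mem_set; exists z.
exists (S, fset_set U); split=> //= x.
rewrite (@fsum_fset _ S); last first.
  by move=> z; rewrite mulf_eq0 negb_or => /andP[_ /hS].
move=> nz; apply: contraNT nz => xU; apply/eqP.
rewrite big_seq big1 // => z zS.
have [->|/(aU _ _ zS)] := eqVneq (a x z) 0; first by rewrite mul0r.
by move=> xU'; rewrite xU' in xU.
Qed.

Lemma cfm_mul_colfin (a b : cfm) y :
  finite_set [set x | \sum_(z \in [set: X]) a x z * b z y != 0].
Proof.
have [[S U] [_ _ /= h]] := cfm_mul_supp a b y.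
by apply: sub_finite_set (finite_fset U) => x /= /h.
Qed.

Definition cfm_mul a b := Cfm (cfm_mul_colfin a b).

Lemma cfm_mulE (a b : cfm) x y (T : {fset X}) :
  (forall z, b z y != 0 -> z \in T) ->
  cfm_mul a b x y = \sum_(z <- T) a x z * b z y.
Proof.
move=> h; apply: fsum_fset => z.
by rewrite mulf_eq0 negb_or => /andP[_ /h].
Qed.

Fact cfm_addA : associative cfm_add.
Proof. by move=> a b c; apply: cfmP => x y /=; rewrite addrA. Qed.
Fact cfm_addC : commutative cfm_add.
Proof. by move=> a b; apply: cfmP => x y /=; rewrite addrC. Qed.
Fact cfm_add0 : left_id cfm_zero cfm_add.
Proof. by move=> a; apply: cfmP => x y /=; rewrite add0r. Qed.
Fact cfm_addN : left_inverse cfm_zero cfm_opp cfm_add.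
Proof. by move=> a; apply: cfmP => x y /=; rewrite addNr. Qed.

HB.instance Definition _ :=
  GRing.isZmodule.Build cfm cfm_addA cfm_addC cfm_add0 cfm_addN.

Lemma cfmDE (a b : cfm) x y : (a + b) x y = a x y + b x y.
Proof. by []. Qed.

Fact cfm_mulA : associative cfm_mul.
Proof.
move=> a b c; apply: cfmP => x y.
have [[S U] [cS bU bcU]] := cfm_mul_supp b c y.
rewrite (@cfm_mulE _ _ _ _ U) // (@cfm_mulE _ _ _ _ S) //.
under eq_bigr do rewrite (@cfm_mulE _ _ _ _ S) // mulr_sumr.
rewrite exchange_big big_seq [RHS]big_seq; apply: eq_bigr => z zS.
rewrite (@cfm_mulE _ _ _ _ U) => [|w]; last exact: bU.
by rewrite mulr_suml; apply: eq_bigr => w _; rewrite mulrA.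
Qed.

Fact cfm_mul1l : left_id cfm_one cfm_mul.
Proof.
move=> a; apply: cfmP => x y.
have [S hS] := cfm_supp a y.
rewrite (@cfm_mulE _ _ _ _ (x |` S)%fset) => [|z /hS zS]; last first.
  by rewrite in_fsetU zS orbT.
rewrite (bigD1_seq x) ?fset_uniq ?fset1U1 //= eqxx mul1r big1 ?addr0 // => z.
by rewrite eq_sym => /negPf ->; rewrite mul0r.
Qed.

Fact cfm_mul1r : right_id cfm_one cfm_mul.
Proof.
move=> a; apply: cfmP => x y.
rewrite (@cfm_mulE _ _ _ _ [fset y]%fset) => [|z]; last first.
  by rewrite in_fset1 /=; have [//|_] := eqVneq z y; rewrite eqxx.
by rewrite big_seq_fset1 /= eqxx mulr1.
Qed.

Fact cfm_mulDl : left_distributive cfm_mul +%R.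
Proof.
move=> a b c; apply: cfmP => x y.
have [S hS] := cfm_supp c y.
rewrite cfmDE !(@cfm_mulE _ _ _ _ S) // -big_split /=.
by apply: eq_bigr => z _; rewrite mulrDl.
Qed.

Fact cfm_mulDr : right_distributive cfm_mul +%R.
Proof.
move=> a b c; apply: cfmP => x y.
have [S hS] := cfm_supp b y; have [T hT] := cfm_supp c y.
have hS' z : b z y != 0 -> z \in (S `|` T)%fset.
  by move=> /hS zS; rewrite in_fsetU zS.
have hT' z : c z y != 0 -> z \in (S `|` T)%fset.
  by move=> /hT zS; rewrite in_fsetU zS orbT.
have hST z : (b + c) z y != 0 -> z \in (S `|` T)%fset.
  move=> nz; have [b0|/hS' //] := eqVneq (b z y) 0.
  by apply: hT'; move: nz; rewrite /= b0 add0r.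
rewrite cfmDE (cfm_mulE _ _ hST) (cfm_mulE _ _ hS') (cfm_mulE _ _ hT').
by rewrite -big_split /=; apply: eq_bigr => z _; rewrite mulrDr.
Qed.

HB.instance Definition _ := GRing.Zmodule_isPzRing.Build cfm
  cfm_mulA cfm_mul1l cfm_mul1r cfm_mulDl cfm_mulDr.

Fact cfm_scaleA k l (a : cfm) : cfm_scale k (cfm_scale l a) = cfm_scale (k * l) a.
Proof. by apply: cfmP => x y /=; rewrite mulrA. Qed.
Fact cfm_scale1 : left_id 1 cfm_scale.
Proof. by move=> a; apply: cfmP => x y /=; rewrite mul1r. Qed.
Fact cfm_scaleDr : right_distributive cfm_scale +%R.
Proof. by move=> k a b; apply: cfmP => x y /=; rewrite mulrDr. Qed.
Fact cfm_scaleDl (a : cfm) : {morph cfm_scale^~ a : k l / k + l}.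
Proof. by move=> k l; apply: cfmP => x y /=; rewrite mulrDl. Qed.

HB.instance Definition _ := GRing.Zmodule_isLmodule.Build K cfm
  cfm_scaleA cfm_scale1 cfm_scaleDr cfm_scaleDl.

Lemma cfm_sumE (J : Type) (s : seq J) (F : J -> cfm) x y :
  (\sum_(j <- s) F j) x y = \sum_(j <- s) F j x y.
Proof. by elim/big_ind2: _ => // a1 a2 b1 b2 <- <-. Qed.

Lemma cfmZE k (a : cfm) x y : (k *: a) x y = k * a x y.
Proof. by []. Qed.

Lemma cfmME (a b : cfm) x y : (a * b) x y = \sum_(z \in [set: X]) a x z * b z y.
Proof. by []. Qed.

Lemma cfm_mulrE (a b : cfm) x y (T : {fset X}) :
  (forall z, b z y != 0 -> z \in T) -> (a * b) x y = \sum_(z <- T) a x z * b z y.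
Proof. exact: cfm_mulE. Qed.

Fact cfm_scaleAl (k : K) (a b : cfm) : k *: (a * b) = (k *: a) * b.
Proof.
apply: cfmP => x y; have [S hS] := cfm_supp b y.
rewrite cfmZE !(cfm_mulrE _ _ hS) mulr_sumr.
by apply: eq_bigr => z _; rewrite mulrA.
Qed.

Fact cfm_scaleAr (k : K) (a b : cfm) : k *: (a * b) = a * (k *: b).
Proof.
apply: cfmP => x y; have [S hS] := cfm_supp b y.
have hkS z : (k *: b) z y != 0 -> z \in S.
  by rewrite cfmZE mulf_eq0 negb_or => /andP[_ /hS].
rewrite cfmZE (cfm_mulrE _ _ hS) (cfm_mulrE _ _ hkS) mulr_sumr.
by apply: eq_bigr => z _ ; rewrite cfmZE !mulrA (mulrC k).
Qed.

(* The ideal of matrices with finitely many nonzero rows. *)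
Definition FR : set cfm := [set a | finite_set [set x | exists y, a x y != 0]].

End ColumnFinite.

Section Index.
Variable aleph : infinite_cardinal.

(* aleph^(A) *)
Definition finsupp (A : Type) : set (A -> aleph) :=
  [set p | finite_set [set a | p a != \bot%O]].
Arguments finsupp : clear implicits.

Definition maxchain d (I : porderType d) : set (set I) :=
  [set A | total_on A (fun x y => (x <= y)%O) /\
           forall B, total_on B (fun x y => (x <= y)%O) -> A `<=` B -> B = A].
Arguments maxchain {d} I.

Definition Xset d (I : porderType d) : choiceType :=
  (set_type (finsupp I) * set_type (maxchain I))%type.

Definition upper d (I : porderType d) (i : I) := {k : I | (i <= k)%O}.

HB.instance Definition _ d (I : porderType d) (i : I) :=
  SubChoice.on (upper i).
HB.instance Definition _ d (I : porderType d) (i : I) :=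
  [SubChoice_isSubPOrder of upper i by <: with d].

Section Restriction.
Variables (d : Order.disp_t) (I : porderType d) (i : I).
Implicit Types x y z : Xset I.

Lemma Xset_eq (J : porderType d) (x y : Xset J) :
  (forall k, val x.1 k = val y.1 k) -> (forall k, val x.2 k <-> val y.2 k) ->
  x = y.
Proof.
case: x y => [p A] [q B] /= pq AB; congr pair; apply: val_inj.
  exact/funext.
by apply/seteqP; split=> k /AB.
Qed.

Lemma restr_finsupp (p : finsupp I) : finsupp (upper i) (fun k : upper i => val p (val k)).
Proof.
apply: (finite_preimage (B := [set a | val p a != \bot%O])).
  by move=> ? ? _ _; exact: val_inj.
exact: set_valP p.
Qed.

Lemma restr_maxchain (A : maxchain I) : val A i ->
  maxchain (upper i) [set k : upper i | val A (val k)].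
Proof.
case: A => A /= /set_mem[totA maxA] Ai; split=> [|B totB AB].
  by move=> k l /= Ak Al; exact: totA.
pose C := [set k | A k /\ (k <= i)%O] `|` [set val k | k in B].
have totC : total_on C (fun k l => (k <= l)%O).
  move=> k l [[Ak ki]|[k' Bk <-]] [[Al li]|[l' Bl <-]].
  - exact: totA.
  - by left; apply: le_trans ki (valP l').
  - by right; apply: le_trans li (valP k').
  - exact: totB.
have AC : A `<=` C.
  move=> k Ak; have [ik|ki] := totA _ _ Ai Ak; last by left.
  by right; exists (exist _ k ik) => //; exact: AB.
apply/seteqP; split=> // k Bk; rewrite /= -(maxA C) //.
by right; exists k.
Qed.

(* The index (p|_{i <=}, A `&` {i <=}), where A contains i. *)
Definition restrX x (xi : val x.2 i) : Xset (upper i) :=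
  (SigSub (mem_set (restr_finsupp x.1)), SigSub (mem_set (restr_maxchain xi))).

(* The condition i \in A `&` B, A `&` {<= i} = B `&` {<= i} and
   p|_{i </=} = q|_{i </=} on a pair of indices (p, A), (q, B). *)
Definition same_off x y : Prop :=
  [/\ val x.2 i, val y.2 i,
      val x.2 `&` [set k | (k <= i)%O] = val y.2 `&` [set k | (k <= i)%O] &
      forall k, ~ (i <= k)%O -> val x.1 k = val y.1 k].

(* For an index x = (p, A) with i \in A, glueX and restrX are inverse
   bijections between X(i <=) and the class of x modulo same_off i. *)
Lemma glue_finsupp (p : finsupp I) (u : finsupp (upper i)) :
  finsupp I (fun k : I => match pselect (i <= k)%O with
                        | left h => val u (exist _ k h)
                        | right _ => val p k end).
Proof.
have fU : finite_set ([set a | val p a != \bot%O] `|`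
    val @` [set a : upper i | val u a != \bot%O]).
  rewrite finite_setU; split; first exact: set_valP p.
  by apply: finite_image; exact: set_valP u.
apply: sub_finite_set fU => k /=; case: pselect => [ik|nik] nz; last by left.
by right; exists (exist _ k ik).
Qed.

Lemma maxchain_bot (E : maxchain (upper i)) : val E (exist _ i (lexx i)).
Proof.
case: E => E /= /set_mem[totE maxE].
pose b : upper i := exist _ i (lexx i); rewrite -[exist _ _ _]/b.
rewrite -(maxE (b |` E)); [by left| |by move=> ? ?; right].
have bot (l : upper i) : (b <= l)%O by exact: (valP l).
move=> k l [->|Ek] [->|El]; first [by left|by right|exact: totE].
Qed.

Lemma glue_maxchain (A : maxchain I) (E : maxchain (upper i)) : val A i ->
  maxchain I ([set k | val A k /\ (k <= i)%O] `|` val @` val E).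
Proof.
move=> Ai; have Ebot := maxchain_bot E.
case: A Ai => A /= /set_mem[totA maxA] Ai.
case: E Ebot => E /= /set_mem[totE maxE] Ebot.
set C := _ `|` _.
have Ci : C i by left.
split=> [|B totB CB].
  move=> k l [[Ak ki]|[k' Bk <-]] [[Al li]|[l' Bl <-]].
  - exact: totA.
  - by left; apply: le_trans ki (valP l').
  - by right; apply: le_trans li (valP k').
  - exact: totE.
apply/seteqP; split=> // b Bb.
have Bi : B i by exact: CB.
have [ib|bi] := totB _ _ Bi Bb.
  right; exists (exist _ b ib) => //.
  rewrite -(maxE [set k : upper i | B (val k)]) //.
    by move=> k l /= Bk Bl; exact: totB.
  by move=> k Ek; apply: CB; right; exists k.
left; split=> //.
pose D := [set k | B k /\ (k <= i)%O] `|` [set k | A k /\ (i <= k)%O].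
rewrite -(maxA D); first by left.
  move=> k l [[Bk ki]|[Ak ik]] [[Bl li]|[Al il]].
  - exact: totB.
  - by left; apply: le_trans ki il.
  - by right; apply: le_trans li ik.
  - exact: totA.
move=> k Ak; have [ik|ki] := totA _ _ Ai Ak; first by right.
by left; split=> //; apply: CB; left.
Qed.

Definition glueX x (xi : val x.2 i) (u : Xset (upper i)) : Xset I :=
  (SigSub (mem_set (glue_finsupp x.1 u.1)),
   SigSub (mem_set (glue_maxchain u.2 xi))).

Lemma glueX_i x (xi : val x.2 i) u : val (glueX xi u).2 i.
Proof. by left. Qed.

Lemma restrX_glueX x (xi : val x.2 i) u (h : val (glueX xi u).2 i) :
  restrX h = u.
Proof.
apply: Xset_eq => k /=.
  case: pselect => [h'|]; last by case; exact: (valP k).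
  by congr (val u.1 _); exact: val_inj.
split=> [[[Ak ki]|[l El /val_inj <-//]]|Ek]; last by right; exists k.
suff -> : k = exist _ i (lexx i) by exact: maxchain_bot.
by apply: val_inj; apply/le_anti; rewrite /= ki (valP k).
Qed.

Lemma same_off_glueX x (xi : val x.2 i) u : same_off x (glueX xi u).
Proof.
split=> //; first exact: glueX_i.
- apply/seteqP; split=> k /=; first by move=> [Ak ki]; split=> //; left.
  move=> [[[]//|[l El lk]] ki]; split=> //.
  suff -> : k = i by [].
  by apply/le_anti; rewrite ki -lk (valP l).
- by move=> k nik /=; case: pselect.
Qed.

Lemma same_off_restrX x y (xi : val x.2 i) (yi : val y.2 i) :
  same_off x y -> glueX xi (restrX yi) = y.
Proof.
case=> _ _ eA ep; apply: Xset_eq => k /=.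
  by case: pselect => // nik; exact: ep.
have eAk : (val x.2 k /\ (k <= i)%O) <-> (val y.2 k /\ (k <= i)%O).
  by rewrite -[X in X <-> _]/((val x.2 `&` [set k | (k <= i)%O]) k) eA.
split=> [[/eAk[]//|[l El <-]//]|yk].
have [totB _] := set_valP y.2.
have [ik|ki] := totB _ _ yi yk; last by left; exact/eAk.
by right; exists (exist _ k ik).
Qed.

Lemma same_offC x y : same_off x y -> same_off y x.
Proof. by case=> ? ? ? h; split=> // k /h. Qed.

Lemma same_off_trans y x z : same_off x y -> same_off y z -> same_off x z.
Proof.
case=> ? ? e1 h1 [? ? e2 h2]; split=> //; first by rewrite e1.
by move=> k nk; rewrite h1 ?h2.
Qed.

End Restriction.

Section Psi.
Variables (K : fieldType) (d : Order.disp_t) (I : porderType d) (i : I).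
Local Notation Q := (cfm K (Xset I)).
Local Notation Qi := (cfm K (Xset (upper i))).

Definition psi_entry (a : Qi) (x y : Xset I) : K :=
  match pselect (same_off i x y) with
  | left (And4 xi yi _ _) => a (restrX xi) (restrX yi)
  | right _ => 0
  end.

Lemma psi_entryE a x y (xi : val x.2 i) (yi : val y.2 i) :
  same_off i x y -> psi_entry a x y = a (restrX xi) (restrX yi).
Proof.
rewrite /psi_entry; case: pselect => // -[xi' yi' _ _] _.
by rewrite (Prop_irrelevance xi xi') (Prop_irrelevance yi yi').
Qed.

Lemma psi_entry0 a x y : ~ same_off i x y -> psi_entry a x y = 0.
Proof. by rewrite /psi_entry; case: pselect. Qed.

Lemma psi_colfin a y : finite_set [set x | psi_entry a x y != 0].
Proof.
have [yi|nyi] := pselect (val y.2 i); last first.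
  apply: (sub_finite_set _ (finite_set0 (Xset I))) => x /=.
  by rewrite psi_entry0 ?eqxx// => -[].
apply: sub_finite_set (finite_image (glueX yi) (cfm_colfin a (restrX yi))) => x /=.
have [xy|nxy] := pselect (same_off i x y); last by rewrite psi_entry0 ?eqxx.
have [xi _ _ _] := xy.
rewrite (psi_entryE _ xi yi) // => nz.
by exists (restrX xi) => //; apply: same_off_restrX; exact: same_offC.
Qed.

Definition psi (a : Qi) : Q := Cfm (psi_colfin a).

Lemma psiD (a b : Qi) : psi (a + b) = psi a + psi b.
Proof.
apply: cfmP => x y; rewrite cfmDE /= /psi_entry.
by case: pselect => [[]|]; rewrite ?addr0.
Qed.

Lemma psiZ (k : K) (a : Qi) : psi (k *: a) = k *: psi a.
Proof.
apply: cfmP => x y; rewrite cfmZE /= /psi_entry.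
by case: pselect => [[]|]; rewrite ?mulr0.
Qed.

Definition is_max := forall k : I, (i <= k)%O -> k = i.

(* The subspace of CFM_{X(i <=)}(K) whose image under psi is H(I,i). *)
Definition coefH : set Qi :=
  [set a : Qi | if pselect is_max then exists k : K, a = k *: (1 : Qi) else FR a].

Definition H : set Q := psi @` coefH.

Lemma HZ (k : K) (x : Q) : H x -> H (k *: x).
Proof.
move=> [a Ha <-]; exists (k *: (a : Qi)); last by rewrite psiZ.
move: Ha; rewrite /coefH /=; case: (pselect is_max) => ?.
  by case=> l ->; exists (k * l); rewrite scalerA.
apply: sub_finite_set => u [v]; rewrite cfmZE mulf_eq0 negb_or => /andP[_ av].
by exists v.
Qed.

(* Products of psi a with a matrix m having the same block structure as psi. *)
Section Product.
Variable m : Q.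
Hypothesis m_inv : forall x y x' y' (xi : val x.2 i) (yi : val y.2 i)
  (xi' : val x'.2 i) (yi' : val y'.2 i),
  same_off i x y -> same_off i x' y' -> restrX xi = restrX xi' ->
  restrX yi = restrX yi' -> m x y = m x' y'.

Lemma glueX_inj x (xi : val x.2 i) : injective (glueX xi).
Proof.
move=> u v uv; rewrite -(restrX_glueX (glueX_i xi u)).
move: (glueX_i xi u); rewrite uv => h; exact: restrX_glueX.
Qed.

Lemma block_colfin x0 (xi0 : val x0.2 i) v :
  finite_set [set u | m (glueX xi0 u) (glueX xi0 v) != 0].
Proof.
apply: (finite_preimage (B := [set x | m x (glueX xi0 v) != 0])).
  by move=> u w _ _; exact: glueX_inj.
exact: cfm_colfin.
Qed.

Definition block x0 (xi0 : val x0.2 i) : Qi := Cfm (block_colfin xi0).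

Lemma blockE x0 (xi0 : val x0.2 i) x y (xi : val x.2 i) (yi : val y.2 i) :
  same_off i x y -> m x y = block xi0 (restrX xi) (restrX yi).
Proof.
move=> xy /=.
apply: (@m_inv _ _ _ _ xi yi (glueX_i xi0 _) (glueX_i xi0 _)) => //; rewrite ?restrX_glueX //.
by apply: same_off_trans (same_off_glueX _ _); apply: same_offC; exact: same_off_glueX.
Qed.

Lemma fsum_glueX (F : Xset I -> K) x (xi : val x.2 i) :
  (forall z, F z != 0 -> same_off i x z) ->
  \sum_(z \in [set: Xset I]) F z = \sum_(u \in [set: Xset (upper i)]) F (glueX xi u).
Proof.
move=> hF; rewrite -(fsbig_image setT (glueX xi) F) => [|u v _ _]; last exact: glueX_inj.
apply: esym; apply: fsbig_widen => // z [_ nz] /=.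
apply/eqP/negP => /negP Fz; apply: nz.
have xz := hF _ Fz; have [_ zi _ _] := xz.
by exists (restrX zi) => //; exact: same_off_restrX.
Qed.

Lemma psi_mull a x0 (xi0 : val x0.2 i) :
  (forall x z y, same_off i x z -> m z y != 0 -> same_off i z y) ->
  psi a * m = psi (a * block xi0).
Proof.
move=> m_l; apply: cfmP => x y; rewrite [RHS]/=.
have [xy|nxy] := pselect (same_off i x y); last first.
  rewrite psi_entry0 // cfmME fsbig1 // => z _.
  have [xz|nxz] := pselect (same_off i x z); last by rewrite /= psi_entry0 // mul0r.
  have [->|nz] := eqVneq (m z y) 0; first by rewrite mulr0.
  by case: nxy; apply: same_off_trans xz (m_l _ _ _ xz nz).
have [xi yi _ _] := xy.
rewrite (psi_entryE _ xi yi) // !cfmME (fsum_glueX (x := x) xi) => [|z]; last first.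
  rewrite mulf_eq0 negb_or => /andP[nz _]; apply: contraPP nz => nxz.
  by rewrite /= psi_entry0 // eqxx.
apply: eq_fsbigr => u _; congr (_ * _).
  rewrite /= (psi_entryE _ xi (glueX_i xi u)) ?restrX_glueX //; exact: same_off_glueX.
rewrite (blockE xi0 (glueX_i xi u) yi) ?restrX_glueX //.
by apply: same_off_trans xy; apply: same_offC; exact: same_off_glueX.
Qed.

Lemma psi_mulr a x0 (xi0 : val x0.2 i) :
  (forall x z y, m x z != 0 -> same_off i z y -> same_off i x z) ->
  m * psi a = psi (block xi0 * a).
Proof.
move=> m_r; apply: cfmP => x y; rewrite [RHS]/=.
have [xy|nxy] := pselect (same_off i x y); last first.
  rewrite psi_entry0 // cfmME fsbig1 // => z _.
  have [zy|nzy] := pselect (same_off i z y); last by rewrite /= psi_entry0 // mulr0.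
  have [->|nz] := eqVneq (m x z) 0; first by rewrite mul0r.
  by case: nxy; apply: same_off_trans (zy); exact: m_r nz zy.
have [xi yi _ _] := xy.
rewrite (psi_entryE _ xi yi) // !cfmME (fsum_glueX (x := x) xi) => [|z]; last first.
  rewrite mulf_eq0 negb_or => /andP[mz nz].
  apply: (m_r x z y mz); apply: contrapT => nzy.
  by move: nz; rewrite /= psi_entry0 // eqxx.
apply: eq_fsbigr => u _; congr (_ * _).
  rewrite (blockE xi0 xi (glueX_i xi u)) ?restrX_glueX //; exact: same_off_glueX.
rewrite /= (psi_entryE _ (glueX_i xi u) yi) ?restrX_glueX //.
by apply: same_off_trans xy; apply: same_offC; exact: same_off_glueX.
Qed.

End Product.
End Psi.

Section Algebra.
Variables (K : fieldType) (d : Order.disp_t) (I : porderType d).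
Local Notation Q := (cfm K (Xset I)).

(* The sum of the subspaces H(I,j) for j in J. *)
Definition Hsum (J : set I) : set Q :=
  [set x | exists s : seq Q,
    (forall y, y \in s -> exists2 j, J j & H j y) /\ x = \sum_(y <- s) y].

Definition frakB : set Q := Hsum [set: I].

Lemma same_offS (i j : I) (x y : Xset I) : (i <= j)%O -> val x.2 i \/ val y.2 i ->
  same_off j x y -> same_off i x y.
Proof.
move=> ij xyi [xj yj exy pxy].
have e k : (k <= j)%O -> val x.2 k <-> val y.2 k.
  move=> kj; have : (val x.2 `&` [set k | (k <= j)%O]) k <->
                    (val y.2 `&` [set k | (k <= j)%O]) k by rewrite exy.
  by move=> [h1 h2]; split=> h; [case: h1|case: h2].
have xi : val x.2 i by case: xyi => // /e; exact.
have yi : val y.2 i by exact/e.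
split=> // [|k nik].
  apply/seteqP; split=> k /= [xk ki]; split=> //; apply/(e k (le_trans ki ij))=> //.
by apply: pxy => jk; apply: nik; exact: le_trans jk.
Qed.

Lemma restrX_eqP (i : I) (x y : Xset I) (xi : val x.2 i) (yi : val y.2 i) :
  restrX xi = restrX yi <-> (forall k, (i <= k)%O ->
    val x.1 k = val y.1 k /\ (val x.2 k <-> val y.2 k)).
Proof.
split=> [e k ik|e].
  pose k' : upper i := exist _ k ik.
  split; first by rewrite -[LHS]/(val (restrX xi).1 k') e.
  by rewrite -[X in X <-> _]/(val (restrX xi).2 k') e.
by apply: Xset_eq => k /=; have [] := e _ (valP k).
Qed.

Lemma psi_compat (i j : I) (b : cfm K (Xset (upper j))) : (i <= j)%O ->
  forall (x y x' y' : Xset I) (xi : val x.2 i) (yi : val y.2 i)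
  (xi' : val x'.2 i) (yi' : val y'.2 i),
  same_off i x y -> same_off i x' y' -> restrX xi = restrX xi' ->
  restrX yi = restrX yi' -> psi b x y = psi b x' y'.
Proof.
move=> ij.
have key (x y x' y' : Xset I) (xi : val x.2 i) (yi : val y.2 i)
    (xi' : val x'.2 i) (yi' : val y'.2 i) :
    same_off i x' y' -> restrX xi = restrX xi' ->
    restrX yi = restrX yi' -> same_off j x y -> same_off j x' y'.
  move=> [_ _ e' p'] /restrX_eqP ex /restrX_eqP ey [xj yj exy pxy].
  split; [by apply/(proj2 (ex _ ij))|by apply/(proj2 (ey _ ij))| |].
    apply/seteqP; split=> k /= [h kj]; split=> //.
      have [/(_ i k xi' h)[ik|ki] _] := set_valP x'.2.
        apply/(proj2 (ey _ ik)).
        have : (val y.2 `&` [set k | (k <= j)%O]) k; last by case.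
        by rewrite -exy; split=> //; apply/(proj2 (ex _ ik)).
      have : (val y'.2 `&` [set k | (k <= i)%O]) k; last by case.
      by rewrite -e'.
    have [/(_ i k yi' h)[ik|ki] _] := set_valP y'.2.
      apply/(proj2 (ex _ ik)).
      have : (val x.2 `&` [set k | (k <= j)%O]) k; last by case.
      by rewrite exy; split=> //; apply/(proj2 (ey _ ik)).
    have : (val x'.2 `&` [set k | (k <= i)%O]) k; last by case.
    by rewrite e'.
  move=> k njk; have [ik|nik] := pselect (i <= k)%O; last exact: p'.
  by rewrite -(proj1 (ex _ ik)) -(proj1 (ey _ ik)) pxy.
move=> x y x' y' xi yi xi' yi' xy xy' ex ey /=.
have [j1|nj1] := pselect (same_off j x y); last first.
  rewrite !psi_entry0 // => j2; apply: nj1.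
  exact: (key _ _ _ _ xi' yi' xi yi).
have j2 : same_off j x' y' by exact: (key _ _ _ _ xi yi xi' yi').
have [[xj yj _ _] [xj' yj' _ _]] := (j1, j2).
rewrite (psi_entryE _ xj yj) // (psi_entryE _ xj' yj') //.
have jk k : (j <= k)%O -> (i <= k)%O by exact: le_trans.
congr (b _ _); apply/restrX_eqP => k /jk ik.
  by move/restrX_eqP : ex; exact.
by move/restrX_eqP : ey; exact.
Qed.

Lemma psi_neq0 (i : I) (a : cfm K (Xset (upper i))) x y :
  psi a x y != 0 -> same_off i x y.
Proof. by move=> nz; apply: contraPP nz => n /=; rewrite psi_entry0 // eqxx. Qed.

Lemma FR_mull (Y : choiceType) (a b : cfm K Y) : FR a -> FR (a * b).
Proof.
apply: sub_finite_set => x [y nz] /=; apply: contrapT => na.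
case/negP: nz; apply/eqP; rewrite cfmME fsbig1 // => z _.
have [->|nz] := eqVneq (a x z) 0; first by rewrite mul0r.
by case: na; exists z.
Qed.

Lemma FR_mulr (Y : choiceType) (a b : cfm K Y) : FR b -> FR (a * b).
Proof.
move=> fb; have fU : finite_set
    (\bigcup_(z in [set z | exists y, b z y != 0]) [set x | a x z != 0]).
  by apply: bigcup_finite => // z _; exact: cfm_colfin.
apply: sub_finite_set fU => x [y nz] /=; apply: contrapT => na.
case/negP: nz; apply/eqP; rewrite cfmME fsbig1 // => z _.
have [->|naz] := eqVneq (a x z) 0; first by rewrite mul0r.
have [->|nb] := eqVneq (b z y) 0; first by rewrite mulr0.
by case: na; exists z => //; exists y.
Qed.

Lemma psi_block (i : I) (b : cfm K (Xset (upper i))) (x0 : Xset I) (xi0 : val x0.2 i) :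
  block (psi b) xi0 = b.
Proof.
apply: cfmP => u v /=.
rewrite (psi_entryE _ (glueX_i xi0 u) (glueX_i xi0 v)) ?restrX_glueX //.
by apply: same_off_trans (same_off_glueX _ _); apply: same_offC; exact: same_off_glueX.
Qed.

Lemma psi_empty (i : I) (a : cfm K (Xset (upper i))) :
  ~ (exists x : Xset I, val x.2 i) -> psi a = 0.
Proof.
move=> n; apply: cfmP => x y /=; rewrite psi_entry0 // => -[xi _ _ _].
by apply: n; exists x.
Qed.

Lemma H0 (i : I) : H i (0 : Q).
Proof.
exists 0; last by rewrite -(scale0r 0) psiZ scale0r.
rewrite /coefH/=; case: (pselect (is_max _)) => ?; first by exists 0; rewrite scale0r.
by apply: (sub_finite_set _ (finite_set0 _)) => x [y] /=; rewrite eqxx.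
Qed.

Lemma H_mul (i j : I) (x y : Q) : H i x -> H j y -> exists k, H k (x * y).
Proof.
case=> a Ha <- [b Hb <-].
have [[x0 xi0]|n] := pselect (exists x : Xset I, val x.2 i); last first.
  by exists i; rewrite (psi_empty _ n) mul0r; exact: H0.
have [[y0 yj0]|n] := pselect (exists x : Xset I, val x.2 j); last first.
  by exists i; rewrite (psi_empty b n) mulr0; exact: H0.
have [eij|nij] := eqVneq i j.
  subst j; exists i.
  rewrite (psi_mull (psi_compat b (lexx i)) a xi0); last by move=> ? ? ? _ /psi_neq0.
  rewrite psi_block; eexists; last by [].
  move: Ha Hb; rewrite /coefH /=; case: (pselect (is_max _)) => ?.
    by case=> k -> [l ->]; exists (k * l); rewrite -cfm_scaleAl mul1r scalerA.
  by move=> fa _; exact: FR_mull.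
have [ij|nleij] := boolP (i <= j)%O.
  exists i; rewrite (psi_mull (psi_compat b ij) a xi0); last first.
    by move=> u v w [_ vi _ _] /psi_neq0; apply: same_offS => //; left.
  eexists; last by [].
  move: Ha; rewrite /coefH /=; case: (pselect (is_max _)) => [mi|?]; last exact: FR_mull.
  by case/eqP: nij; exact/esym/mi.
have [ji|nleji] := boolP (j <= i)%O.
  exists j; rewrite (psi_mulr (psi_compat a ji) b yj0); last first.
    by move=> u v w /psi_neq0 uv [vj _ _ _]; apply: same_offS uv => //; right.
  eexists; last by [].
  move: Hb; rewrite /coefH /=; case: (pselect (is_max _)) => [mj|?]; last exact: FR_mulr.
  by case/eqP: nij; exact: mj.
exists i; suff -> : psi a * psi b = 0 by exact: H0.
apply: cfmP => u v; rewrite cfmME fsbig1 // => z _.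
have [->|/psi_neq0[_ zi _ _]] := eqVneq (psi a u z) 0; first by rewrite mul0r.
have [->|/psi_neq0[zj _ _ _]] := eqVneq (psi b z v) 0; first by rewrite mulr0.
have [/(_ _ _ zi zj)[ij|ji] _] := set_valP z.2.
  by rewrite ij in nleij.
by rewrite ji in nleji.
Qed.

Lemma Hsum0 J : Hsum J 0.
Proof. by exists [::]; split=> //; rewrite big_nil. Qed.

Lemma HsumD J (x y : Q) : Hsum J x -> Hsum J y -> Hsum J (x + y).
Proof.
move=> [s [hs ->]] [t [ht ->]]; exists (s ++ t); split; last by rewrite big_cat.
by move=> z; rewrite mem_cat => /orP[/hs|/ht].
Qed.

Lemma HsumZ J (k : K) (x : Q) : Hsum J x -> Hsum J (k *: x).
Proof.
move=> [s [hs ->]]; exists [seq k *: z | z <- s].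
split; last by rewrite big_map scaler_sumr.
by move=> _ /mapP[z /hs[j Jj Hz] ->]; exists j => //; exact: HZ.
Qed.

Lemma HsumH (J : set I) (j : I) (x : Q) : J j -> H j x -> Hsum J x.
Proof.
move=> Jj Hx; exists [:: x]; split; last by rewrite big_seq1.
by move=> y; rewrite inE => /eqP ->; exists j.
Qed.

Lemma Hsum_sum J (T : eqType) (s : seq T) (F : T -> Q) :
  (forall t, t \in s -> Hsum J (F t)) -> Hsum J (\sum_(t <- s) F t).
Proof.
move=> h; rewrite big_seq; elim/big_ind: _ => //; first exact: Hsum0.
exact: HsumD.
Qed.

Lemma frakB_mul_in (x y : Q) : frakB x -> frakB y -> frakB (x * y).
Proof.
move=> [s [hs ->]] [t [ht ->]]; rewrite mulr_suml; apply: Hsum_sum => u us.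
rewrite mulr_sumr; apply: Hsum_sum => v vt.
have [[i _ Hu] [j _ Hv]] := (hs _ us, ht _ vt).
by have [k Hk] := H_mul Hu Hv; exact: (HsumH (j := k)).
Qed.

Definition finite_cofinal := exists C : set I,
  finite_set C /\ forall i, exists2 c, C c & (i <= c)%O.

Lemma maxchain_nonempty (A : maxchain I) (i : I) : exists j, val A j.
Proof.
apply: contrapT => n; have [_ maxA] := set_valP A.
have : val A i by rewrite -(maxA [set i]) // => [? ? -> ->|j Aj]; [left|case: n; exists j].
by move=> Ai; apply: n; exists i.
Qed.

Lemma psi1E (j : I) (jmax : is_max j) (x y : Xset I) :
  psi (1 : cfm K (Xset (upper j))) x y =
  ((x == y) && `[< val x.2 j >])%:R.
Proof.
have [xj|nxj] := pselect (val x.2 j); last first.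
  by rewrite (asboolF nxj) andbF /= psi_entry0 // => -[].
rewrite (asboolT xj) andbT.
have [<-|nxy] := eqVneq x y.
  by rewrite /= (psi_entryE _ xj xj) //= eqxx.
rewrite /=; have [xy|] := pselect (same_off j x y); last exact: psi_entry0.
have [_ yj _ _] := xy.
rewrite (psi_entryE _ xj yj) //=; case: eqVneq => // e.
case/eqP: nxy; rewrite -(same_off_restrX xj yj xy) -e.
by apply/esym; exact: same_off_restrX.
Qed.

Lemma frakB_1 : finite_cofinal -> (exists i : I, True) -> frakB 1.
Proof.
move=> [C [fC hC]] [i0 _].
pose s := [seq j <- fset_set C | `[< is_max j >]].
have smax j : j \in s -> is_max j by rewrite mem_filter => /andP[/asboolP].
have maxs j : is_max j -> j \in s.
  move=> mj; rewrite mem_filter (asboolT mj) /= in_fset_set // inE.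
  by have [c Cc jc] := hC j; rewrite -(mj _ jc).
suff -> : 1 = \sum_(j <- s) psi (1 : cfm K (Xset (upper j))).
  apply: Hsum_sum => j js; apply: (HsumH (j := j)) => //; exists 1 => //.
  rewrite /coefH /=; case: (pselect (is_max j)) => [?|/(_ (smax _ js))//].
  by exists 1; rewrite scale1r.
apply: cfmP => x y; rewrite cfm_sumE [LHS]/= big_seq.
rewrite (eq_bigr (fun j => ((x == y) && `[< val x.2 j >])%:R)); last first.
  by move=> j js; rewrite psi1E //; exact: smax.
rewrite -big_seq; have [->|nxy] := eqVneq x y; last by rewrite big1.
rewrite /=.
have [totA maxA] := set_valP y.2.
have [j0 Aj0] := maxchain_nonempty y.2 i0.
have [j yj topj] : exists2 j, val y.2 j & forall k, val y.2 k -> (k <= j)%O.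
  have [c Cc ctop] : exists2 c, C c & forall k, val y.2 k -> (k <= c)%O.
    apply: contrapT => n.
    have h c : exists k, C c -> val y.2 k /\ ~ (k <= c)%O.
      have [Cc|] := pselect (C c); last by exists i0.
      apply: contrapT => n'; apply: n; exists c => // k yk.
      by apply: contrapT => nkc; apply: n'; exists k.
    have [g gP] := choice h.
    have [k yk ktop] : exists2 k, val y.2 k & forall c, c \in enum_fset (fset_set C) -> (g c <= k)%O.
      have : forall c, c \in enum_fset (fset_set C) -> val y.2 (g c).
        move=> c hc; have : c \in fset_set C by [].
        by rewrite in_fset_set // inE => /gP[].
      elim: (enum_fset (fset_set C)) => [|c t IH] ht; first by exists j0.
      have [|k yk ktop] := IH; first by move=> e et; apply: ht; rewrite inE et orbT.
      have yc : val y.2 (g c) by apply: ht; rewrite inE eqxx.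
      have [ck|kc] := totA _ _ yc yk.
        by exists k => // e; rewrite inE => /orP[/eqP ->//|/ktop].
      exists (g c) => // e; rewrite inE => /orP[/eqP ->//|/ktop ek].
      exact: le_trans kc.
    have [c Cc kc] := hC k; have [_] := gP _ Cc; apply.
    apply: le_trans kc; apply: ktop.
    by suff : c \in fset_set C by []; rewrite in_fset_set // inE.
  exists c => //; rewrite -(maxA (c |` val y.2)); first by left.
    move=> k l [->|yk] [->|yl]; [by left|by right; exact: ctop|by left; exact: ctop|].
    exact: totA.
  by move=> k yk; right.
have jmax : is_max j.
  move=> k jk; apply/le_anti; rewrite jk andbT; apply: (topj).
  rewrite -(maxA (k |` val y.2)); first by left.
    move=> l l' [->|yl] [->|yl']; [by left|right|left|exact: totA].
      by apply: le_trans (jk); exact: topj.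
    by apply: le_trans (jk); exact: topj.
  by move=> l yl; right.
rewrite (bigD1_seq j) /=; [|exact: maxs|exact/filter_uniq/fset_uniq].
rewrite (asboolT yj) /= big_seq_cond big1 ?addr0 // => k /andP[ks nkj].
rewrite asboolF // => yk; case/eqP: nkj.
by apply/esym/(smax _ ks); exact: topj.
Qed.

End Algebra.

Arguments frakB K {d} I.
Arguments finite_cofinal {d} I.

Section SubAlgebra.
Variables (K : fieldType) (d : Order.disp_t) (I : porderType d).
Local Notation Q := (cfm K (Xset I)).

Definition frakB_sort := {x : Q | x \in frakB K I}.

HB.instance Definition _ := SubChoice.on frakB_sort.

Fact frakB_submod : submod_closed (fun x : Q => x \in frakB K I).
Proof.
split=> [|k x y /set_mem Bx /set_mem By]; first exact/mem_set/Hsum0.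
by apply: mem_set; apply: HsumD By; exact: HsumZ.
Qed.

HB.instance Definition _ := GRing.SubChoice_isSubLmodule.Build K Q
  (fun x : Q => x \in frakB K I) frakB_sort frakB_submod.

Definition frakB_mul (x y : frakB_sort) : frakB_sort :=
  exist _ (val x * val y)
    (mem_set (frakB_mul_in (set_mem (valP x)) (set_mem (valP y)))).

Hypothesis cofI : finite_cofinal I.

(* If I is empty then frakB I = 0, although 1 != 0 in Q(I). *)
Definition frakB_one_val : Q := if pselect (exists i : I, True) then 1 else 0.

Lemma frakB_one_in : frakB_one_val \in frakB K I.
Proof.
apply: mem_set; rewrite /frakB_one_val; case: pselect => /= [i|_].
  exact: frakB_1.
exact: Hsum0.
Qed.

Definition frakB_one : frakB_sort := exist _ frakB_one_val frakB_one_in.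

Lemma frakB_oneP (x : Q) : frakB K I x -> frakB_one_val * x = x /\ x * frakB_one_val = x.
Proof.
rewrite /frakB_one_val; case: pselect => /= [_|n]; first by rewrite mul1r mulr1.
case=> s [hs ->]; suff -> : s = [::] by rewrite big_nil mul0r.
case: s hs => // y s /(_ y); rewrite inE eqxx => /(_ isT)[i].
by case: n; exists i.
Qed.

Fact frakB_mulA : associative frakB_mul.
Proof. by move=> x y z; apply: val_inj; rewrite /= mulrA. Qed.
Fact frakB_mul1l : left_id frakB_one frakB_mul.
Proof. by move=> x; apply: val_inj; have [] := frakB_oneP (set_mem (valP x)). Qed.
Fact frakB_mul1r : right_id frakB_one frakB_mul.
Proof. by move=> x; apply: val_inj; have [] := frakB_oneP (set_mem (valP x)). Qed.
Fact frakB_linearl y : linear (frakB_mul^~ y).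
Proof.
by move=> k x x'; apply: val_inj; rewrite /= mulrDl cfm_scaleAl.
Qed.
Fact frakB_linearr x : linear (frakB_mul x).
Proof.
by move=> k y y'; apply: val_inj; rewrite /= mulrDr cfm_scaleAr.
Qed.

Definition frakB_algebra : unital_algebra K :=
  UnitalAlgebra frakB_mulA frakB_mul1l frakB_mul1r frakB_linearl frakB_linearr.

End SubAlgebra.

Record pos_obj := PosObj {
  pos_disp : Order.disp_t;
  pos_sort :> porderType pos_disp;
  pos_card : ([set: pos_sort] #<= [set: aleph])%card;
  pos_maxchain : (maxchain pos_sort #<= [set: aleph])%card;
  pos_cofinal : finite_cofinal pos_sort
}.

Record pos_hom (I J : pos_obj) := PosHom {
  pos_fun :> I -> J;
  pos_mono : {mono pos_fun : i i' / (i <= i')%O};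
  pos_upper : forall i j, (pos_fun i <= j)%O -> exists k, pos_fun k = j
}.

Lemma pos_hom_eq (I J : pos_obj) (f g : pos_hom I J) : f =1 g -> f = g.
Proof.
case: f g => [f f1 f2] [g g1 g2] /= fg; have e : f = g by exact/funext.
by subst g; congr PosHom; exact: Prop_irrelevance.
Qed.

Definition pos_id (I : pos_obj) : pos_hom I I.
Proof. by exists id => // i j _; exists j. Defined.

Definition pos_comp (I J L : pos_obj) (g : pos_hom J L) (f : pos_hom I J) :
  pos_hom I L.
Proof.
exists (g \o f) => [i i'|i l /= /[dup] gfl /pos_upper[j gj]].
  by rewrite /= !pos_mono.
move: gfl; rewrite -gj pos_mono => /pos_upper[k <-].
by exists k.
Defined.

Section Action.
Variables (K : fieldType) (I J : pos_obj) (f : pos_hom I J).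

Section Component.
Variable i : I.

Lemma upper_map_le (k : upper i) : (f i <= f (val k))%O.
Proof. by rewrite pos_mono; exact: (valP k). Qed.

(* The restriction of f to an order isomorphism {i <=} -> {f i <=}. *)
Definition upper_map (k : upper i) : upper (f i) :=
  exist _ (f (val k)) (upper_map_le k).

Lemma upper_map_mono (k l : upper i) : (upper_map k <= upper_map l)%O = (k <= l)%O.
Proof. exact: (pos_mono f). Qed.

Lemma upper_map_inj : injective upper_map.
Proof. by move=> k l e; apply/le_anti; rewrite -!upper_map_mono e lexx. Qed.

Lemma upper_map_surj (l : upper (f i)) : exists k, upper_map k = l.
Proof.
have [k fk] := pos_upper (valP l); have ik := valP l.
rewrite /= -fk pos_mono in ik.
by exists (exist _ k ik); apply: val_inj.
Qed.

Lemma pull_finsupp (u : finsupp (upper (f i))) :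
  finsupp (upper i) (fun k => val u (upper_map k)).
Proof.
apply: (finite_preimage (B := [set a | val u a != \bot%O])).
  by move=> ? ? _ _; exact: upper_map_inj.
exact: set_valP u.
Qed.

Lemma pull_maxchain (E : maxchain (upper (f i))) :
  maxchain (upper i) (upper_map @^-1` val E).
Proof.
case: E => E /= /set_mem[totE maxE]; split=> [k l Ek El|B totB EB].
  by rewrite -!upper_map_mono; exact: totE.
apply/seteqP; split=> // k Bk; rewrite /= -(maxE (upper_map @` B)).
- by exists k.
- move=> _ _ [k' Bk' <-] [l' Bl' <-]; rewrite !upper_map_mono; exact: totB.
- move=> l El; have [k' ek] := upper_map_surj l.
  by exists k' => //; apply: EB; rewrite /= ek.
Qed.

Definition pullX (u : Xset (upper (f i))) : Xset (upper i) :=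
  (SigSub (mem_set (pull_finsupp u.1)), SigSub (mem_set (pull_maxchain u.2))).

Lemma pullX_inj : injective pullX.
Proof.
move=> u v [e1 e2].
apply: Xset_eq => l; have [k <-] := upper_map_surj l.
  exact: (congr1 (@^~ k) e1).
by rewrite -[X in X <-> _]/((upper_map @^-1` val u.2) k) e2.
Qed.

Lemma tilde_colfin (a : cfm K (Xset (upper i))) v :
  finite_set [set u | a (pullX u) (pullX v) != 0].
Proof.
apply: (finite_preimage (B := [set x | a x (pullX v) != 0])).
  by move=> ? ? _ _; exact: pullX_inj.
exact: cfm_colfin.
Qed.

Definition tilde (a : cfm K (Xset (upper i))) : cfm K (Xset (upper (f i))) :=
  Cfm (tilde_colfin a).

(* psi i is injective, so that this sends psi i a to psi (f i) (tilde a). *)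
Definition hat_comp (x : cfm K (Xset I)) : cfm K (Xset J) :=
  psi (tilde (xget 0 [set a | psi a = x])).

End Component.
End Action.

(* The sum of the H(I,i) is direct, so that this is the family of the
   components of x, for x in frakB(I). *)
Definition components (K : fieldType) d (I : porderType d)
    (x : cfm K (Xset I)) : I -> cfm K (Xset I) :=
  xget (fun=> 0) [set h | [/\ forall i, H i (h i),
    finite_set [set i | h i != 0] & x = \sum_(i \in [set: I]) h i]].

Section Maps.
Variables (K : fieldType) (I J : pos_obj) (f : pos_hom I J).

Definition hat (x : cfm K (Xset I)) : cfm K (Xset J) :=
  \sum_(i \in [set: I]) hat_comp f i (components x i).

(* The projection onto H(J,f(I)) with kernel H(J, J \ f(I)). *)
Definition proj_range (y : cfm K (Xset J)) : cfm K (Xset J) :=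
  \sum_(j \in range f) components y j.

(* The inverse image under the bijection hat : frakB(I) -> H(J,f(I)). *)
Definition hat_inv (y : cfm K (Xset J)) : cfm K (Xset I) :=
  xget 0 [set x | frakB K I x /\ hat x = y].

(* frakB_map and frakB_star_map are functions on all of Q(I) and Q(J), of
   which only the restrictions to the subalgebras frakB(I) and frakB(J) are
   used. *)
Definition frakB_map (x : cfm K (Xset I)) : cfm K (Xset J) := hat x.

Definition frakB_star_map (y : cfm K (Xset J)) : cfm K (Xset I) :=
  hat_inv (proj_range y).

End Maps.

Definition frakB_obj (K : fieldType) (I : pos_obj) : unital_algebra K :=
  frakB_algebra K (pos_cofinal I).

Definition frakB_incl (K : fieldType) (I : pos_obj) (x : frakB_obj K I) :
  cfm K (Xset I) := val (x : frakB_sort K I).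

End Index.

Record alg_hom (K : fieldType) (A B : unital_algebra K) := AlgHom {
  alg_fun :> A -> B;
  alg_linear : linear alg_fun;
  alg_mulM : {morph alg_fun : x y / ualg_mul x y}
}.

Lemma alg_hom_eq (K : fieldType) (A B : unital_algebra K) (f g : alg_hom A B) :
  f =1 g -> f = g.
Proof.
case: f g => [f f1 f2] [g g1 g2] /= fg; have e : f = g by exact/funext.
by subst g; congr AlgHom; exact: Prop_irrelevance.
Qed.

Definition alg_id (K : fieldType) (A : unital_algebra K) : alg_hom A A.
Proof. by exists id. Defined.

Definition alg_comp (K : fieldType) (A B C : unital_algebra K)
  (g : alg_hom B C) (f : alg_hom A B) : alg_hom A C.
Proof.
exists (g \o f) => [k x y|x y] /=; first by rewrite !alg_linear.
by rewrite !alg_mulM.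
Defined.

Record category := Category {
  obj :> Type;
  hom : obj -> obj -> Type;
  idm : forall a, hom a a;
  comp : forall a b c, hom b c -> hom a b -> hom a c;
  comp_idl : forall a b (f : hom a b), comp (idm b) f = f;
  comp_idr : forall a b (f : hom a b), comp f (idm a) = f;
  comp_assoc : forall a b c e (h : hom c e) (g : hom b c) (f : hom a b),
    comp h (comp g f) = comp (comp h g) f
}.
Arguments idm {_} a.
Arguments comp {_ _ _ _} g f : rename.

Definition op (C : category) : category :=
  @Category C (fun a b => hom b a) (fun a => idm a) (fun _ _ _ g f => comp f g)
    (fun _ _ f => comp_idr f) (fun _ _ f => comp_idl f)
    (fun _ _ _ _ h g f => esym (comp_assoc f g h)).

Record functor_on (C D : category) (F0 : C -> D) := FunctorOn {
  fmap : forall a b, hom a b -> hom (F0 a) (F0 b);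
  fmap_id : forall a, fmap (idm a) = idm (F0 a);
  fmap_comp : forall a b c (g : hom b c) (f : hom a b),
    fmap (comp g f) = comp (fmap g) (fmap f)
}.

Definition Pos (aleph : infinite_cardinal) : category.
Proof.
by refine (@Category (pos_obj aleph) (@pos_hom aleph) (@pos_id aleph)
  (@pos_comp aleph) _ _ _) => *; exact: pos_hom_eq.
Defined.

Definition Alg (K : fieldType) : category.
Proof.
by refine (@Category (unital_algebra K) (@alg_hom K) (@alg_id K)
  (@alg_comp K) _ _ _) => *; exact: alg_hom_eq.
Defined.

(* Main.v *)
(* The sum of the H(I,i) is direct because, at an index i maximal among those
   of a vanishing sum, the component is constant along variations of p(k) for
   k < i, while the components at k < i have finitely many nonzero rows; as
   aleph is infinite, some variation kills all but the component at i.
   An element of H(I,i) times one of H(I,j) lies in H(I,min(i,j)), or is 0 if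
   i and j are incomparable, and the factor psi_j b acts on the i-blocks by a
   matrix that depends only on {i <=}, on which f is an isomorphism: hence
   B(f) is multiplicative.  As f(I) is an upper set, the span of the H(J,j)
   with j outside f(I) is an ideal, so that B*(f) is multiplicative too; its
   functoriality follows from hat f (B*(f) y) = proj y and the injectivity of
   hat f. *)
From mathcomp Require Import all_boot all_order all_algebra.
From mathcomp Require Import finmap all_classical.
Require Import Defs.

Set Implicit Arguments.
Unset Strict Implicit.
Unset Printing Implicit Defensive.

Import Order.TTheory GRing.Theory.

Local Open Scope classical_set_scope.
Local Open Scope ring_scope.

(** * Existence of maximal chains and of maximal elements *)

Lemma maxchain_through d (I : porderType d) (i : I) :
  exists2 A : set I, maxchain A & A i.
Proof.
(* Zorn's lemma also asks about the union of the empty family, so [i] is adjoined inside the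
   property instead of being required to lie in [B]. A maximal [A] contains [i], because adjoining
   [i] preserves the property. *)
pose P (B : set I) := total_on (i |` B) (fun x y => (x <= y)%O).
have [F FP totF|A [PA maxA]] := @Zorn_bigcup I P.
  move=> k l [->|[B FB Bk]] [->|[C FC Cl]].
  - by left.
  - by apply: (FP _ FC); [left|right].
  - by apply: (FP _ FB); [right|left].
  - have [BC|CB] := totF _ _ FB FC.
      by apply: (FP _ FC); right => //; exact: BC.
    by apply: (FP _ FB); right => //; exact: CB.
have Ai : A i.
  apply: contrapT => nAi; apply: (maxA (i |` A)).
    by split=> [|/(_ i (or_introl erefl))]; [exact: subsetUr|].
  by rewrite /P setUA setUid.
exists A => //; split=> [|B totB AB].
  by move=> k l Ak Al; apply: PA; right.
apply: contrapT => nBA; apply: (maxA B).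
  by split=> // BA; apply: nBA; apply/seteqP.
by move: totB; rewrite /P (setUidr (B := B)) // => _ ->; exact: AB.
Qed.

Lemma seq_maximal d (I : porderType d) (s : seq I) i : i \in s ->
  exists2 m, m \in s & forall j, j \in s -> (m <= j)%O -> j = m.
Proof.
elim: s i => // c [|e t] IH i _.
  by exists c => [|j]; rewrite inE // => /eqP.
have [m mt maxm] := IH e (mem_head _ _).
have [mc|nmc] := boolP (m <= c)%O; last first.
  exists m; first by rewrite inE mt orbT.
  by move=> j; rewrite inE => /orP[/eqP ->|/maxm//]; rewrite (negPf nmc).
exists c; first exact: mem_head.
move=> j; rewrite inE => /orP[/eqP //|jt] cj.
by apply/le_anti; rewrite cj (maxm _ jt (le_trans mc cj)) mc.
Qed.

(** * Independence of the subspaces H(I,i) *)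

Section Independence.
Variables (aleph : infinite_cardinal) (K : fieldType).
Variables (d : Order.disp_t) (I : porderType d).
Local Notation X := (Xset aleph I).
Local Notation Q := (cfm K X).

(** Supplies the base points at which [block] reads a matrix off its image under [psi]. *)
Lemma Xset_through (i : I) : exists x : X, val x.2 i.
Proof.
have [A maxA Ai] := maxchain_through i.
have fin0 : finsupp (fun _ : I => \bot%O : aleph).
  by rewrite /finsupp /=; apply: (sub_finite_set _ (finite_set0 I)) => k /=; rewrite eqxx.
by exists (SigSub (mem_set fin0), SigSub (mem_set maxA)).
Qed.

Lemma psi_inj (i : I) : injective (@psi aleph K d I i).
Proof.
move=> a b ab; have [x xi] := Xset_through i.
by rewrite -(psi_block a xi) ab psi_block.
Qed.

Lemma shift_finsupp (r : seq I) (v : aleph) (p : @finsupp aleph I) :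
  finsupp (fun k => if k \in r then v else val p k).
Proof.
have fU : finite_set ([set` r] `|` [set a | val p a != \bot%O]).
  by rewrite finite_setU; split; [exact: finite_seq|exact: set_valP p].
by apply: sub_finite_set fU => k /=; case: ifP => [|_]; [left|right].
Qed.

(** The variation used for independence: it is applied to the row and the column index at once, and
    the chain is kept. *)
Definition shiftX (r : seq I) (v : aleph) (x : X) : X :=
  (SigSub (mem_set (shift_finsupp r v x.1)), x.2).

(** Since [r] avoids the elements above [i], the shift does not change the restrictions to the upper
    set of [i], and off that set it changes both indices in the same way. *)
Lemma psi_shiftX (i : I) (a : cfm K (Xset aleph (upper i))) r v x y :
  (forall k, k \in r -> ~~ (i <= k)%O) -> same_off i x y ->
  psi a (shiftX r v x) (shiftX r v y) = psi a x y.
Proof.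
move=> rni xy; have [xi yi exy pxy] := xy.
have off (z : X) (zi zi' : val z.2 i) :
    restrX (x := shiftX r v z) zi = restrX zi'.
  apply/restrX_eqP => k ik; split=> //=.
  by case: ifP => // /rni; rewrite ik.
apply: (@psi_compat _ _ _ _ i i a (lexx i) (shiftX r v x) (shiftX r v y) x y
  xi yi xi yi) => //.
by split=> // k nik /=; case: ifP => // _; exact: pxy.
Qed.

Lemma HS_FR (i j : I) (x : Q) : (i < j)%O -> H i x ->
  exists2 a : cfm K (Xset aleph (upper i)), FR a & psi a = x.
Proof.
move=> ij [a + <-]; rewrite /coefH /=.
case: (pselect (is_max i)) => [mi _|nmi fa].
  by move: (ij); rewrite (mi _ (ltW ij)) ltxx.
by exists a.
Qed.

(* Only finitely many shifts of the value at k hit a nonzero row. *)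
Lemma shiftX_finite (k i : I) (r : seq I) (h : Q) (x y : X) :
  H k h -> k \in r -> ~~ (i <= k)%O -> val x.2 i ->
  finite_set [set v | h (shiftX r v x) (shiftX r v y) != 0].
Proof.
move=> Hk kr nik xi.
have [xk|nxk] := pselect (val x.2 k); last first.
  apply: (sub_finite_set _ (finite_set0 _)) => v /=.
  by case: Hk => a _ <- /psi_neq0[].
have [tot _] := set_valP x.2.
have [ik|ki] := tot _ _ xi xk; first by rewrite ik in nik.
have lki : (k < i)%O by rewrite lt_leAnge ki.
have [a fa <-] := HS_FR lki Hk.
apply: sub_finite_set (finite_preimage
  (f := fun v => restrX (x := shiftX r v x) xk) _ fa).
  move=> v nz /=; have xy := psi_neq0 nz; have [xk' yk' _ _] := xy.
  exists (restrX yk'); move: nz; rewrite /= (psi_entryE _ xk' yk') //.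
  by rewrite (Prop_irrelevance xk' xk).
(* As [k] belongs to [r], the restricted row index takes the value [v] at [k] itself, so distinct
   [v] give distinct rows of [a]. *)
move=> v w _ _ /(congr1 (fun z => val z.1 (exist _ k (lexx k)))) /=.
by rewrite kr.
Qed.

(* If i is maximal among the indices involved, then varying the values
   p(k), k < i, leaves the component at i unchanged and makes the other
   components vanish, as these have finitely many nonzero rows per block. *)
Lemma H_independent (T : choiceType) (g : T -> I) (h : T -> Q) (s : seq T) :
  injective g -> uniq s -> (forall t, H (g t) (h t)) -> \sum_(t <- s) h t = 0 ->
  forall t, t \in s -> h t = 0.
Proof.
move=> ginj us Hh sum0 t1 t1s; apply/eqP; apply: contraT => nz1.
(* Zero terms are discarded so that the maximal index found next belongs to a nonzero term. *)
pose s' := [seq t <- s | h t != 0].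
have t1s' : g t1 \in [seq g t | t <- s'] by rewrite map_f // mem_filter nz1.
have [_ /mapP[t0 t0s' ->] max0] := seq_maximal t1s'.
have us' : uniq s' by exact: filter_uniq.
have sum0' : \sum_(t <- s') h t = 0.
  rewrite big_filter -[RHS]sum0 [RHS](bigID (fun t => h t != 0)) /=.
  by rewrite [X in _ + X]big1 ?addr0 // => t; rewrite negbK => /eqP.
have [x [y nz]] : exists x y, h t0 x y != 0.
  apply: contrapT => n; move: t0s'; rewrite mem_filter => /andP[/eqP[]].
  apply: cfmP => x y; apply/eqP; apply: contraT => nz.
  by case: n; exists x, y.
(* [r] lists the indices of the other nonzero terms. By maximality none lies above [g t0], so
   [psi_shiftX] applies to [h t0] and [shiftX_finite] to the others. *)
pose s0 := [seq t <- s' | t != t0]; pose r := [seq g t | t <- s0].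
have rP k : k \in r -> ~~ (g t0 <= k)%O.
  move=> /mapP[t]; rewrite mem_filter => /andP[tt0 ts'] ->.
  apply/negP => /(max0 _ (map_f _ ts'))/ginj e.
  by rewrite e eqxx in tt0.
have [a0 _ ha0] := Hh t0.
have xy : same_off (g t0) x y by move: nz; rewrite -ha0 => /psi_neq0.
have [xi _ _ _] := xy.
have fin : finite_set (\bigcup_(t in [set` s0])
    [set v | h t (shiftX r v x) (shiftX r v y) != 0]).
  apply: bigcup_finite => [|t /= ts0]; first exact: finite_seq.
  apply: (shiftX_finite _ (Hh t) _ _ xi); first exact: map_f.
  by apply: rP; exact: map_f.
have [v vP] : exists v, forall t, t \in s0 ->
    h t (shiftX r v x) (shiftX r v y) = 0.
  apply: contrapT => n; apply: (@card_infinite aleph).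
  apply: sub_finite_set fin => v _; apply: contrapT => nv; apply: n.
  exists v => t ts0; apply/eqP; apply: contraT => nzt.
  by case: nv; exists t.
move/(congr1 (fun m : Q => m (shiftX r v x) (shiftX r v y))): sum0'.
rewrite cfm_sumE (bigD1_seq t0) //= -big_filter -/s0 big_seq big1 // addr0.
by rewrite -ha0 psi_shiftX // ha0 => /eqP; rewrite (negPf nz).
Qed.

End Independence.

Lemma fsumTE (T : choiceType) (V : nmodType) (F : T -> V) (A : set T) :
  finite_set A -> (forall t, F t != 0 -> A t) ->
  \sum_(t \in [set: T]) F t = \sum_(t <- fset_set A) F t.
Proof.
move=> fA FA; apply: fsbigTE => t; rewrite in_fset_set // => nAt.
by apply/eqP; apply: contraNT nAt => /FA /mem_set.
Qed.

(** * Components and products *)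

Section Components.
Variables (aleph : infinite_cardinal) (K : fieldType).
Variables (d : Order.disp_t) (I : porderType d).
Local Notation X := (Xset aleph I).
Local Notation Q := (cfm K X).
Implicit Types (i j : I) (x y : Q) (h : I -> Q).

Lemma HD (i : I) x y : H i x -> H i y -> H i (x + y).
Proof.
move=> [a Ha <-] [b Hb <-]; exists (a + b); last exact: psiD.
move: Ha Hb; rewrite /coefH /=; case: (pselect (is_max i)) => ?.
  by move=> [k ea] [l eb]; exists (k + l); rewrite scalerDl ea eb.
move=> fa fb; have fU : finite_set ([set u | exists v, a u v != 0] `|`
    [set u | exists v, b u v != 0]) by rewrite finite_setU.
apply: sub_finite_set fU => u [v] /=.
have [->|nz _] := eqVneq (a u v) 0; last by left; exists v.
by rewrite add0r => nz; right; exists v.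
Qed.

Lemma H_linear (i : I) k x y : H i x -> H i y -> H i (k *: x + y).
Proof. by move=> Hx Hy; apply: HD => //; exact: HZ. Qed.

Lemma Hsum_linear (J : set I) k x y :
  Hsum J x -> Hsum J y -> Hsum J (k *: x + y).
Proof. by move=> Hx Hy; apply: HsumD => //; exact: HsumZ. Qed.

(** Membership in [frakB] is carried along with [P], because the maps to which this is applied are
    linear only there. *)
Lemma frakB_ind (P : Q -> Prop) :
  P 0 -> (forall x y, frakB x -> P x -> frakB y -> P y -> P (x + y)) ->
  (forall i x, H i x -> P x) -> forall x, frakB x -> P x.
Proof.
move=> P0 PD PH x [s [hs ->]].
suff [] : frakB (\sum_(y <- s) y) /\ P (\sum_(y <- s) y) by [].
rewrite big_seq; elim/big_ind: _ => //.
- by split=> //; exact: Hsum0.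
- by move=> y z [By Py] [Bz Pz]; split; [exact: HsumD|exact: PD].
- by move=> y /hs[i _ Hy]; split; [exact: (HsumH (j := i))|exact: PH Hy].
Qed.

(** Maps such as [hat] are defined on all of Q(I) through choices that are controlled only on
    [frakB]. *)
Definition linear_on_frakB (V : lmodType K) (F : Q -> V) :=
  forall k x y, frakB x -> frakB y -> F (k *: x + y) = k *: F x + F y.

Lemma linear_on_frakB0 (V : lmodType K) (F : Q -> V) :
  linear_on_frakB F -> F 0 = 0.
Proof.
move=> linF; have B0 : frakB (0 : Q) by exact: Hsum0.
(* The scalar -1 at zero arguments yields [F 0 = - F 0 + F 0]. *)
by have := linF (-1) _ _ B0 B0; rewrite scaler0 addr0 scaleN1r addNr.
Qed.

Lemma linear_on_frakBD (V : lmodType K) (F : Q -> V) : linear_on_frakB F ->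
  forall x y, frakB x -> frakB y -> F (x + y) = F x + F y.
Proof. by move=> linF x y Bx By; have := linF 1 _ _ Bx By; rewrite !scale1r. Qed.

Lemma eq_on_frakB (V : lmodType K) (F G : Q -> V) :
  linear_on_frakB F -> linear_on_frakB G ->
  (forall i x, H i x -> F x = G x) -> forall x, frakB x -> F x = G x.
Proof.
move=> linF linG FG; apply: frakB_ind => [|x y Bx eFx By eFy|//].
  by rewrite !linear_on_frakB0.
by rewrite !linear_on_frakBD // eFx eFy.
Qed.

(** The set from which [components] chooses. *)
Definition decomposition x : set (I -> Q) :=
  [set h | [/\ forall i, H i (h i),
    finite_set [set i | h i != 0] & x = \sum_(i \in [set: I]) h i]].

Lemma decomposition_linear k x y h h' :
  decomposition x h -> decomposition y h' ->
  decomposition (k *: x + y) (fun i => k *: h i + h' i).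
Proof.
move=> [Hh fh ->] [Hh' fh' ->].
set A := [set i | h i != 0]; set B := [set i | h' i != 0].
have fU : finite_set (A `|` B) by rewrite finite_setU.
have hU i : h i != 0 -> (A `|` B) i by left.
have hU' i : h' i != 0 -> (A `|` B) i by right.
have hhU i : k *: h i + h' i != 0 -> (A `|` B) i.
  have [->|/hU //] := eqVneq (h i) 0.
  by rewrite scaler0 add0r => /hU'.
split=> [i||]; first exact: H_linear.
  by apply: sub_finite_set fU => i; exact: hhU.
rewrite (fsumTE fU hU) (fsumTE fU hU') (fsumTE fU hhU).
by rewrite scaler_sumr big_split.
Qed.

Lemma decomposition0 : decomposition 0 (fun=> 0).
Proof.
split=> [i||]; first exact: H0.
  by apply: (sub_finite_set _ (finite_set0 I)) => i /=; rewrite eqxx.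
by rewrite fsbig1.
Qed.

Lemma decomposition_H i x : H i x ->
  decomposition x (fun j => if j == i then x else 0).
Proof.
move=> Hx; have sub j : (if j == i then x else 0) != 0 -> [set i] j.
  by case: (eqVneq j i) => // _; rewrite eqxx.
split=> [j||].
- by case: (eqVneq j i) => [->//|_]; exact: H0.
- exact: sub_finite_set (finite_set1 i).
- by rewrite (fsumTE (finite_set1 i) sub) fset_set1 big_seq_fset1 /= eqxx.
Qed.

(** The difference of two decompositions decomposes 0, so [H_independent] makes it vanish. Hence the
    choice in [components] is forced on [frakB]. *)
Lemma decomposition_inj x h h' :
  decomposition x h -> decomposition x h' -> h = h'.
Proof.
move=> dh dh'; have := decomposition_linear (-1) dh dh'.
rewrite scaleN1r addNr => -[Hg fg sum0].
have sub i : -1 *: h i + h' i != 0 -> [set i | -1 *: h i + h' i != 0] i by [].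
move: sum0; rewrite (fsumTE fg sub) => /esym sum0.
apply/funext => i; apply/esym/eqP; rewrite -subr_eq0 addrC -scaleN1r.
apply: contraT => nz; have := nz.
by rewrite (H_independent (g := id) _ _ Hg sum0) ?eqxx // in_fset_set // inE.
Qed.

Lemma components_eq x h : decomposition x h -> components x = h.
Proof.
move=> dh; apply: (decomposition_inj _ dh).
exact: (@xgetPex _ (fun=> 0) (decomposition x) (ex_intro _ h dh)).
Qed.

Lemma componentsP x : frakB x -> decomposition x (components x).
Proof.
move=> Bx; suff [h dh] : exists h, decomposition x h by rewrite (components_eq dh).
move: x Bx; apply: frakB_ind => [|x y _ [h dh] _ [h' dh']|i x Hx].
- by exists (fun=> 0); exact: decomposition0.
- by exists (fun i => 1 *: h i + h' i); rewrite -[x]scale1r; exact: decomposition_linear.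
- by exists (fun j => if j == i then x else 0); exact: decomposition_H.
Qed.

Section ComponentSum.
Variables (V : lmodType K) (phi : I -> Q -> V).
Hypothesis phi_linear : forall i k x y, H i x -> H i y ->
  phi i (k *: x + y) = k *: phi i x + phi i y.

(** Common form of [hat] and [proj_range]: the extension to [frakB] of maps given on each H(I,i). *)
Definition component_sum x := \sum_(i \in [set: I]) phi i (components x i).

Lemma component_map0 i : phi i 0 = 0.
Proof.
have := phi_linear (-1) (H0 aleph K i) (H0 aleph K i).
by rewrite scaler0 addr0 scaleN1r addNr.
Qed.

Lemma component_sumE x (A : set I) : finite_set A ->
  (forall i, components x i != 0 -> A i) ->
  component_sum x = \sum_(i <- fset_set A) phi i (components x i).
Proof.
move=> fA hA; apply: fsumTE => // i nz; apply: hA; apply: contraNneq nz => ->.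
by rewrite component_map0.
Qed.

Lemma component_sum_linear : linear_on_frakB component_sum.
Proof.
move=> k x y Bx By.
have [dx dy] := (componentsP Bx, componentsP By).
have ez := components_eq (decomposition_linear k dx dy).
have [[Hx fx _] [Hy fy _]] := (dx, dy).
set A := [set i | components x i != 0] in fx.
set B := [set i | components y i != 0] in fy.
have fU : finite_set (A `|` B) by rewrite finite_setU.
have hx i : components x i != 0 -> (A `|` B) i by left.
have hy i : components y i != 0 -> (A `|` B) i by right.
have hz i : components (k *: x + y) i != 0 -> (A `|` B) i.
  rewrite ez; have [->|/hx //] := eqVneq (components x i) 0.
  by rewrite scaler0 add0r => /hy.
rewrite (component_sumE fU hx) (component_sumE fU hy) (component_sumE fU hz).
rewrite scaler_sumr -big_split; apply: eq_bigr => i _ /=.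
by rewrite ez phi_linear.
Qed.

Lemma component_sum_H i x : H i x -> component_sum x = phi i x.
Proof.
move=> Hx; have ex := components_eq (decomposition_H Hx).
rewrite (component_sumE (finite_set1 i)) => [|j]; last first.
  by rewrite ex; case: (eqVneq j i) => // _; rewrite eqxx.
by rewrite fset_set1 big_seq_fset1 ex eqxx.
Qed.

End ComponentSum.

(** For [i <= j] the factor [psi b] preserves every [i]-block and acts on all of them by the same
    matrix. The explicit coefficient is what will be compared with its image under a morphism. *)
Lemma psi_mulL i j (a : cfm K (Xset aleph (upper i)))
    (b : cfm K (Xset aleph (upper j))) (z : X) (zi : val z.2 i) :
  (i <= j)%O -> psi a * psi b = psi (a * block (psi b) zi).
Proof.
move=> ij; apply: (psi_mull (psi_compat b ij) a zi) => u v w [_ vi _ _] /psi_neq0.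
by apply: same_offS => //; left.
Qed.

Lemma psi_mulR i j (a : cfm K (Xset aleph (upper i)))
    (b : cfm K (Xset aleph (upper j))) (z : X) (zj : val z.2 j) :
  (j <= i)%O -> psi a * psi b = psi (block (psi a) zj * b).
Proof.
move=> ji; apply: (psi_mulr (psi_compat a ji) b zj) => u v w /psi_neq0 uv [vj _ _ _].
by apply: same_offS uv => //; right.
Qed.

(** A middle index contributing to an entry of the product would have both [i] and [j] in its
    chain. *)
Lemma psi_mul_incomparable i j (a : cfm K (Xset aleph (upper i)))
    (b : cfm K (Xset aleph (upper j))) :
  ~~ (i <= j)%O -> ~~ (j <= i)%O -> psi a * psi b = 0.
Proof.
move=> nij nji; apply: cfmP => u v; rewrite cfmME fsbig1 // => z _.
have [->|/psi_neq0[_ zi _ _]] := eqVneq (psi a u z) 0; first by rewrite mul0r.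
have [->|/psi_neq0[zj _ _ _]] := eqVneq (psi b z v) 0; first by rewrite mulr0.
have [/(_ _ _ zi zj)[ij|ji] _] := set_valP z.2.
  by rewrite ij in nij.
by rewrite ji in nji.
Qed.

(** For [i = j] the block is [b] itself. For [i < j] the element [i] is not maximal, and matrices
    with finitely many nonzero rows absorb factors on the right. *)
Lemma coefH_mulL i j (a : cfm K (Xset aleph (upper i)))
    (b : cfm K (Xset aleph (upper j))) (z : X) (zi : val z.2 i) :
  (i <= j)%O -> coefH a -> coefH b -> coefH (a * block (psi b) zi).
Proof.
move=> ij; have [eij|nij] := eqVneq i j.
  subst j; rewrite psi_block /coefH /=; case: (pselect (is_max _)) => ?.
    by case=> k -> [l ->]; exists (k * l); rewrite -cfm_scaleAl mul1r scalerA.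
  by move=> fa _; exact: FR_mull.
rewrite /coefH /=; case: (pselect (is_max i)) => [mi|? fa _]; last exact: FR_mull.
by case/eqP: nij; exact/esym/mi.
Qed.

Lemma coefH_mulR i j (a : cfm K (Xset aleph (upper i)))
    (b : cfm K (Xset aleph (upper j))) (z : X) (zj : val z.2 j) :
  (j <= i)%O -> coefH a -> coefH b -> coefH (block (psi a) zj * b).
Proof.
move=> ji; have [eij|nij] := eqVneq i j.
  subst j; rewrite psi_block /coefH /=; case: (pselect (is_max _)) => ?.
    by case=> k -> [l ->]; exists (k * l); rewrite -cfm_scaleAl mul1r scalerA.
  by move=> fa _; exact: FR_mull.
rewrite /coefH /=; case: (pselect (is_max j)) => [mj|? _ fb]; last exact: FR_mulr.
by case/eqP: nij; exact: mj.
Qed.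

(** Sharpens [H_mul] by locating the product; [proj_rangeM_H] needs to know the component. *)
Lemma H_mul_min i j x y : H i x -> H j y ->
  [\/ (i <= j)%O /\ H i (x * y), (j <= i)%O /\ H j (x * y) | x * y = 0].
Proof.
move=> [a Ha <-] [b Hb <-].
have [[u ui] [v vj]] := (Xset_through aleph i, Xset_through aleph j).
have [ij|nij] := boolP (i <= j)%O.
  constructor 1; split=> //; exists (a * block (psi b) ui); last exact/esym/psi_mulL.
  exact: coefH_mulL.
have [ji|nji] := boolP (j <= i)%O.
  constructor 2; split=> //; exists (block (psi a) vj * b); last exact/esym/psi_mulR.
  exact: coefH_mulR.
by constructor 3; exact: psi_mul_incomparable.
Qed.

End Components.

(** * Transport along a morphism *)

Section Transport.
Variables (aleph : infinite_cardinal) (K : fieldType).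
Variables (I J : pos_obj aleph) (f : pos_hom I J).
Local Notation pull := (@pullX aleph I J f _).

Lemma pos_inj : injective f.
Proof. by move=> k l e; apply/le_anti; rewrite -!(pos_mono f) e lexx. Qed.

(** Everything above [f i] comes from above [i], as the image is an upper set. This makes the two
    cases in [coefH] correspond under [f]. *)
Lemma is_max_map (i : I) : is_max (f i) <-> is_max i.
Proof.
split=> mi k ik.
  by apply/pos_inj/mi; rewrite pos_mono.
have [l fl] := pos_upper ik; rewrite -fl; congr (f _); apply: mi.
by rewrite -(pos_mono f) fl.
Qed.

Section Index.
Variable i : I.

Lemma pullX_surj (w : Xset aleph (upper i)) : exists u, pull u = w.
Proof.
have [g gK] := choice (upper_map_surj (f := f) (i := i)).
have fin : finsupp (fun l => val w.1 (g l)).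
  apply: (finite_preimage (B := [set a | val w.1 a != \bot%O])).
    by move=> k l _ _ e; rewrite -(gK k) e gK.
  exact: set_valP w.1.
have gK' k : g (upper_map f k) = k by apply: (upper_map_inj (f := f)); rewrite gK.
have g_mono k l : (g k <= g l)%O = (k <= l)%O by rewrite -(upper_map_mono f) !gK.
have maxE : maxchain (g @^-1` val w.2).
  have [totw maxw] := set_valP w.2; split=> [k l wk wl|B totB wB].
    by rewrite -!g_mono; exact: totw.
  apply/seteqP; split=> // k Bk; rewrite /= -(maxw (upper_map f (i := i) @^-1` B)).
  - by rewrite /= gK.
  - by move=> l l' Bl Bl'; rewrite -!(upper_map_mono f); exact: totB.
  - by move=> l wl; apply: wB; rewrite /= gK'.
exists (SigSub (mem_set fin), SigSub (mem_set maxE)).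
by apply: Xset_eq => k /=; rewrite gK'.
Qed.

Lemma tilde_inj : injective (@tilde aleph K I J f i).
Proof.
move=> a b ab; apply: cfmP => u v.
have [[u' <-] [v' <-]] := (pullX_surj u, pullX_surj v).
by rewrite -[LHS]/(tilde f a u' v') ab.
Qed.

Lemma tilde_surj (b : cfm K (Xset aleph (upper (f i)))) : exists a, tilde f a = b.
Proof.
have [g gK] := choice pullX_surj.
have gK' u : g (pull u) = u by apply: (@pullX_inj aleph I J f _); rewrite gK.
have fin v : finite_set [set u | b (g u) (g v) != 0].
  apply: (finite_preimage (B := [set x | b x (g v) != 0])).
    by move=> k l _ _ e; rewrite -(gK k) e gK.
  exact: cfm_colfin.
by exists (Cfm fin); apply: cfmP => u v /=; rewrite !gK'.
Qed.

Lemma tilde_linear k (a b : cfm K (Xset aleph (upper i))) :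
  tilde f (k *: a + b) = k *: tilde f a + tilde f b.
Proof. exact: cfmP. Qed.

Lemma tildeZ k (a : cfm K (Xset aleph (upper i))) :
  tilde f (k *: a) = k *: tilde f a.
Proof. exact: cfmP. Qed.

Lemma tilde1 : tilde f (1 : cfm K (Xset aleph (upper i))) = 1.
Proof. by apply: cfmP => u v /=; rewrite (inj_eq (@pullX_inj aleph I J f _)). Qed.

Lemma tildeM (a b : cfm K (Xset aleph (upper i))) :
  tilde f (a * b) = tilde f a * tilde f b.
Proof.
apply: cfmP => u v; rewrite -[LHS]/((a * b) (pull u) (pull v)) !cfmME.
apply: (@reindex_fsbigT _ _ _ _ _ (@pullX aleph I J f i)).
have [g gK] := choice pullX_surj; exists g => // w.
by apply: (@pullX_inj aleph I J f _); rewrite gK.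
Qed.

Lemma tilde_coefH (a : cfm K (Xset aleph (upper i))) :
  coefH (tilde f a) <-> coefH a.
Proof.
rewrite /coefH /=; case: (pselect (is_max i)) => mi; case: (pselect (is_max (f i))) => mfi.
- split=> -[k e]; exists k; last by rewrite e tildeZ tilde1.
  by apply: tilde_inj; rewrite e tildeZ tilde1.
- by case: mfi; apply/is_max_map.
- by case: mi; apply/is_max_map.
split=> fa.
  apply: sub_finite_set (finite_image (@pullX aleph I J f i) fa) => u [v nz].
  have [[u' eu] [v' ev]] := (pullX_surj u, pullX_surj v).
  by exists u' => //; exists v'; rewrite /= eu ev.
apply: sub_finite_set (finite_preimage (f := @pullX aleph I J f i) _ fa) => [u [v nz]|].
  by exists (pull v).
by move=> u v _ _; exact: pullX_inj.
Qed.

End Index.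

(** Counterpart of [psi_compat] across two posets: for [i <= j], entries of [psi b] within an
    [i]-block depend only on the upper set of [i], which [f] identifies with that of [f i]. *)
Lemma psi_transport (i j : I) (b : cfm K (Xset aleph (upper j)))
    (x y : Xset aleph J) (x' y' : Xset aleph I)
    (xi : val x.2 (f i)) (yi : val y.2 (f i)) (xi' : val x'.2 i) (yi' : val y'.2 i) :
  (i <= j)%O -> same_off (f i) x y -> same_off i x' y' ->
  restrX xi' = pull (restrX xi) -> restrX yi' = pull (restrX yi) ->
  psi (tilde f b) x y = psi b x' y'.
Proof.
move=> ij xy xy' ex ey.
have [ex1 ex2] : (forall k, (i <= k)%O -> val x'.1 k = val x.1 (f k)) /\
    (forall k, (i <= k)%O -> val x'.2 k <-> val x.2 (f k)).
  split=> k ik; pose k' : upper i := exist _ k ik.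
    by rewrite -[LHS]/(val (restrX xi').1 k') ex.
  by rewrite -[X in X <-> _]/(val (restrX xi').2 k') ex.
have [ey1 ey2] : (forall k, (i <= k)%O -> val y'.1 k = val y.1 (f k)) /\
    (forall k, (i <= k)%O -> val y'.2 k <-> val y.2 (f k)).
  split=> k ik; pose k' : upper i := exist _ k ik.
    by rewrite -[LHS]/(val (restrX yi').1 k') ey.
  by rewrite -[X in X <-> _]/(val (restrX yi').2 k') ey.
have [_ _ exy pxy] := xy; have [_ _ exy' pxy'] := xy'.
have [[totx _] [toty _]] := (set_valP x.2, set_valP y.2).
have [[totx' _] [toty' _]] := (set_valP x'.2, set_valP y'.2).
have low (k : J) : (k <= f i)%O -> val x.2 k <-> val y.2 k.
  move=> ki; have : (val x.2 `&` [set k | (k <= f i)%O]) k <->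
    (val y.2 `&` [set k | (k <= f i)%O]) k by rewrite exy.
  by move=> [h1 h2]; split=> h; [case: h1|case: h2].
have low' (k : I) : (k <= i)%O -> val x'.2 k <-> val y'.2 k.
  move=> ki; have : (val x'.2 `&` [set k | (k <= i)%O]) k <->
    (val y'.2 `&` [set k | (k <= i)%O]) k by rewrite exy'.
  by move=> [h1 h2]; split=> h; [case: h1|case: h2].
(* Chain elements are comparable with [i] or [f i]. Above it the data correspond by [ex1], [ex2],
   [ey1], [ey2]; below it the two chains of a pair agree by [low] or [low']. Values of p off the
   upper set agree by [pxy] or [pxy']. *)
have iff_off : same_off (f j) x y <-> same_off j x' y'.
  split=> -[xj yj e p].
    have mid k : (k <= j)%O -> val x.2 (f k) <-> val y.2 (f k).
      move=> kj; have : (val x.2 `&` [set k | (k <= f j)%O]) (f k) <->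
        (val y.2 `&` [set k | (k <= f j)%O]) (f k) by rewrite e.
      by rewrite /= pos_mono kj => -[h1 h2]; split=> h; [case: h1|case: h2].
    split; [exact/ex2|exact/ey2| |].
      apply/seteqP; split=> k [h kj]; split=> //.
        have [ik|ki] := totx' _ _ xi' h; last exact/low'.
        by apply/ey2/mid/ex2.
      have [ik|ki] := toty' _ _ yi' h; last exact/low'.
      by apply/ex2/mid/ey2.
    move=> k njk; have [ik|nik] := pselect (i <= k)%O; last exact: pxy'.
    by rewrite ex1 // ey1 // p // pos_mono.
  have mid k : (k <= j)%O -> val x'.2 k <-> val y'.2 k.
    move=> kj; have : (val x'.2 `&` [set k | (k <= j)%O]) k <->
      (val y'.2 `&` [set k | (k <= j)%O]) k by rewrite e.
    by move=> -[h1 h2]; split=> h; [case: h1|case: h2].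
  split; [exact/ex2|exact/ey2| |].
    apply/seteqP; split=> l [h lj]; split=> //.
      have [il|li] := totx _ _ xi h; last exact/low.
      (* Being above [f i], the element [l] lies in the image of [f]. *)
      have [k fk] := pos_upper il; move: h lj il; rewrite -fk /= !pos_mono => h kj ik.
      by apply/ey2 => //; apply/mid => //; apply/ex2.
    have [il|li] := toty _ _ yi h; last exact/low.
    have [k fk] := pos_upper il; move: h lj il; rewrite -fk /= !pos_mono => h kj ik.
    by apply/ex2 => //; apply/mid => //; apply/ey2.
  move=> l njl; have [il|nil] := pselect (f i <= l)%O; last exact: pxy.
  have [k fk] := pos_upper il; move: njl il; rewrite -fk !pos_mono => njk ik.
  by rewrite -ex1 // -ey1 // p.
have [xyj|nxyj] := pselect (same_off j x' y'); last first.
  by rewrite /= !psi_entry0 // => /iff_off.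
have xyfj : same_off (f j) x y by exact/iff_off.
have [[xj yj _ _] [xj' yj' _ _]] := (xyfj, xyj).
rewrite /= (psi_entryE _ xj yj) // (psi_entryE _ xj' yj') //=.
have up (k : upper j) : (i <= val k)%O by exact: le_trans ij (valP k).
by congr (b _ _); apply: Xset_eq => k;
  [exact: (esym (ex1 _ (up k)))|exact: (iff_sym (ex2 _ (up k)))
  |exact: (esym (ey1 _ (up k)))|exact: (iff_sym (ey2 _ (up k)))].
Qed.

(** The base points [x] and [y] are unrelated: gluing into them indices that correspond under
    [pullX] gives the situation of [psi_transport]. *)
Lemma tilde_block (i j : I) (b : cfm K (Xset aleph (upper j)))
    (x : Xset aleph I) (xi : val x.2 i) (y : Xset aleph J) (yi : val y.2 (f i)) :
  (i <= j)%O -> tilde f (block (psi b) xi) = block (psi (tilde f b)) yi.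
Proof.
move=> ij; apply: cfmP => u v; apply/esym.
apply: (@psi_transport i j b _ _ _ _ (glueX_i yi u) (glueX_i yi v)
  (glueX_i xi (pull u)) (glueX_i xi (pull v))) => //; rewrite ?restrX_glueX //.
  by apply: same_off_trans (same_off_glueX _ _); apply: same_offC; exact: same_off_glueX.
by apply: same_off_trans (same_off_glueX _ _); apply: same_offC; exact: same_off_glueX.
Qed.

Lemma hat_comp_psi (i : I) (a : cfm K (Xset aleph (upper i))) :
  hat_comp f i (psi a) = psi (tilde f a).
Proof.
congr (psi (tilde f _)); apply: (@psi_inj aleph).
exact: (@xgetPex _ 0 [set b | psi b = psi a] (ex_intro _ a erefl)).
Qed.

Lemma hat_comp_H (i : I) x : H i x -> H (f i) (hat_comp (K := K) f i x).
Proof.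
move=> [a Ha <-]; rewrite hat_comp_psi; exists (tilde f a) => //.
exact/tilde_coefH.
Qed.

Lemma hat_comp_linear (i : I) k x y : H i x -> H i y ->
  hat_comp (K := K) f i (k *: x + y) = k *: hat_comp f i x + hat_comp f i y.
Proof.
move=> [a _ <-] [b _ <-]; rewrite -psiZ -psiD !hat_comp_psi tilde_linear.
by rewrite psiD psiZ.
Qed.

(** * The map [hat]: linearity, multiplicativity, bijectivity onto H(J,f(I)) *)

Lemma hat_linear : linear_on_frakB (hat (K := K) f).
Proof. exact: component_sum_linear hat_comp_linear. Qed.

Lemma hat_H (i : I) x : H i x -> hat (K := K) f x = hat_comp f i x.
Proof. exact: component_sum_H hat_comp_linear _ _. Qed.

Lemma hat_range x : frakB x -> Hsum (range f) (hat (K := K) f x).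
Proof.
move: x; apply: frakB_ind => [|x y Bx Hx By Hy|i x Hx].
- by rewrite (linear_on_frakB0 hat_linear); exact: Hsum0.
- by rewrite (linear_on_frakBD hat_linear) //; exact: HsumD.
- by rewrite (hat_H Hx); apply: (HsumH (j := f i)); [exists i|exact: hat_comp_H].
Qed.

(** An order embedding preserves and reflects comparability, so both products fall under the same
    case; then [tilde] is multiplicative and carries blocks to blocks. *)
Lemma hatM_H (i j : I) x y : H i x -> H j y ->
  hat (K := K) f (x * y) = hat f x * hat f y.
Proof.
move=> Hx Hy; rewrite (hat_H Hx) (hat_H Hy).
case: Hx Hy => a Ha <- [b Hb <-]; rewrite !hat_comp_psi.
have [[u ui] [v vj]] := (Xset_through aleph i, Xset_through aleph j).
have [[u' ui'] [v' vj']] := (Xset_through aleph (f i), Xset_through aleph (f j)).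
have [ij|nij] := boolP (i <= j)%O.
  rewrite (psi_mulL _ _ ui) // (psi_mulL _ _ ui') ?pos_mono //.
  rewrite (hat_H (i := i)); last first.
    by exists (a * block (psi b) ui) => //; exact: coefH_mulL.
  by rewrite hat_comp_psi tildeM (tilde_block b ui ui').
have [ji|nji] := boolP (j <= i)%O.
  rewrite (psi_mulR _ _ vj) // (psi_mulR _ _ vj') ?pos_mono //.
  rewrite (hat_H (i := j)); last first.
    by exists (block (psi a) vj * b) => //; exact: coefH_mulR.
  by rewrite hat_comp_psi tildeM (tilde_block a vj vj').
rewrite !psi_mul_incomparable ?pos_mono //.
exact: linear_on_frakB0 hat_linear.
Qed.

Lemma hatM x y : frakB x -> frakB y -> hat (K := K) f (x * y) = hat f x * hat f y.
Proof.
move=> Bx; move: x Bx y; apply: frakB_ind => [|x x' Bx hx Bx' hx'|i x Hx] y By.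
- by rewrite mul0r (linear_on_frakB0 hat_linear) mul0r.
- rewrite mulrDl !(linear_on_frakBD hat_linear) ?hx ?hx' ?mulrDl //; exact: frakB_mul_in.
have Bx : frakB x by exact: (HsumH (j := i)).
move: y By; apply: frakB_ind => [|y y' By hy By' hy'|j y Hy].
- by rewrite mulr0 (linear_on_frakB0 hat_linear) mulr0.
- rewrite mulrDr !(linear_on_frakBD hat_linear) ?hy ?hy' ?mulrDr //; exact: frakB_mul_in.
- exact: hatM_H Hx Hy.
Qed.

Lemma hat_frakB x : frakB x -> frakB (hat (K := K) f x).
Proof. by move=> /hat_range[s [hs ->]]; exists s; split=> // y /hs[j _ Hy]; exists j. Qed.

Lemma hat_comp_eq0 (i : I) x : H i x -> hat_comp (K := K) f i x = 0 -> x = 0.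
Proof.
(* The right-hand zero is expressed as the image of zero, so that injectivity of [psi] and [tilde]
   applies. *)
rewrite -(component_map0 hat_comp_linear i) => -[a _ <-].
have [b _ <-] := H0 aleph K i.
by rewrite !hat_comp_psi => /psi_inj/tilde_inj ->.
Qed.

(** By injectivity of [f] the components are sent to distinct summands H(J,f(i)), whose independence
    is [H_independent] with the indexing map [f]. *)
Lemma hat_eq0 x : frakB x -> hat (K := K) f x = 0 -> x = 0.
Proof.
move=> Bx; have [Hx fx xE] := componentsP Bx.
set A := [set i | components x i != 0] in fx.
have hA i : components x i != 0 -> A i by [].
rewrite /hat -/(component_sum _ _) (component_sumE hat_comp_linear fx hA) => sum0.
rewrite xE fsbig1 // => i _; apply/eqP; apply: contraT => nz; have := nz.
rewrite (@hat_comp_eq0 i _ (Hx i)) ?eqxx //.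
apply: (H_independent pos_inj (fset_uniq _) (fun j => hat_comp_H (Hx j)) sum0).
by rewrite in_fset_set // inE.
Qed.

Lemma hat_inj x y : frakB x -> frakB y -> hat (K := K) f x = hat f y -> x = y.
Proof.
move=> Bx By e; apply/eqP; rewrite eq_sym -subr_eq0 addrC -scaleN1r; apply/eqP.
apply: hat_eq0; first exact: Hsum_linear.
by rewrite hat_linear // e scaleN1r addNr.
Qed.

Lemma hat_surj y : Hsum (range f) y -> exists2 x, frakB x & hat (K := K) f x = y.
Proof.
move=> [s [hs ->]]; rewrite big_seq; elim/big_ind: _ => [|y1 y2|z /hs].
- by exists 0; [exact: Hsum0|rewrite (linear_on_frakB0 hat_linear)].
- move=> [x1 B1 <-] [x2 B2 <-]; exists (x1 + x2); first exact: HsumD.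
  exact: linear_on_frakBD hat_linear _ _ B1 B2.
move=> [_ [i _ <-] [b Hb <-]]; have [a ab] := tilde_surj b.
have Ha : H i (psi a) by exists a => //; apply/tilde_coefH; rewrite ab.
exists (psi a); first exact: (HsumH (j := i)).
by rewrite (hat_H Ha) hat_comp_psi ab.
Qed.

(** * The projection onto H(J,f(I)) *)

Lemma range_comp_linear (j : J) k (x y : cfm K (Xset aleph J)) :
  H j x -> H j y ->
  (if j \in range f then k *: x + y else 0) =
  k *: (if j \in range f then x else 0) + (if j \in range f then y else 0).
Proof. by case: ifP => // _ _ _; rewrite scaler0 addr0. Qed.

Lemma proj_rangeE (y : cfm K (Xset aleph J)) : proj_range f y =
  component_sum (fun j z => if j \in range f then z else 0) y.
Proof. by rewrite /proj_range -[range f]setTI fsbig_mkcondr setTI. Qed.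

Lemma proj_range_linear : linear_on_frakB (proj_range (K := K) f).
Proof.
move=> k x y; rewrite !proj_rangeE; exact: component_sum_linear range_comp_linear _ _ _.
Qed.

Lemma proj_range_H (j : J) (y : cfm K (Xset aleph J)) : H j y ->
  proj_range f y = if j \in range f then y else 0.
Proof. by rewrite proj_rangeE => /(component_sum_H range_comp_linear). Qed.

Lemma proj_range_in (y : cfm K (Xset aleph J)) :
  frakB y -> Hsum (range f) (proj_range f y).
Proof.
move: y; apply: frakB_ind => [|x y Bx Hx By Hy|j y Hy].
- by rewrite (linear_on_frakB0 proj_range_linear); exact: Hsum0.
- by rewrite (linear_on_frakBD proj_range_linear) //; exact: HsumD.
- rewrite (proj_range_H Hy); case: ifPn => [/set_mem fj|_]; last exact: Hsum0.
  exact: HsumH Hy.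
Qed.

Lemma range_upper (j k : J) : (j <= k)%O -> j \in range f -> k \in range f.
Proof.
move=> jk /set_mem[i _ fi]; rewrite -fi in jk.
by have [l <-] := pos_upper jk; apply/mem_set; exists l.
Qed.

(* The complement of the upper set f(I) is a lower set, so that the kernel of
   the projection is an ideal. *)
Lemma proj_rangeM_H (j k : J) (x y : cfm K (Xset aleph J)) : H j x -> H k y ->
  proj_range f (x * y) = proj_range f x * proj_range f y.
Proof.
move=> Hx Hy; rewrite (proj_range_H Hx) (proj_range_H Hy).
case: (H_mul_min Hx Hy) => [[jk Hxy]|[kj Hxy]|xy0].
- rewrite (proj_range_H Hxy); case: ifPn => [/(range_upper jk) -> //|_].
  by rewrite mul0r.
- rewrite (proj_range_H Hxy); case: ifPn => [/(range_upper kj) -> //|_].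
  by rewrite mulr0.
- rewrite xy0 (linear_on_frakB0 proj_range_linear).
  by case: ifP; case: ifP; rewrite ?mul0r ?mulr0.
Qed.

Lemma proj_rangeM (x y : cfm K (Xset aleph J)) : frakB x -> frakB y ->
  proj_range f (x * y) = proj_range f x * proj_range f y.
Proof.
have lin0 := linear_on_frakB0 proj_range_linear.
have linD := linear_on_frakBD proj_range_linear.
move=> Bx; move: x Bx y; apply: frakB_ind => [|x x' Bx hx Bx' hx'|i x Hx] y By.
- by rewrite mul0r lin0 mul0r.
- rewrite mulrDl !linD ?hx ?hx' ?mulrDl //; exact: frakB_mul_in.
have Bx : frakB x by exact: (HsumH (j := i)).
move: y By; apply: frakB_ind => [|y y' By hy By' hy'|j y Hy].
- by rewrite mulr0 lin0 mulr0.
- rewrite mulrDr !linD ?hy ?hy' ?mulrDr //; exact: frakB_mul_in.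
- exact: proj_rangeM_H Hx Hy.
Qed.

(** * The contravariant map *)

Lemma frakB_star_mapP (y : cfm K (Xset aleph J)) : frakB y ->
  frakB (frakB_star_map f y) /\ hat f (frakB_star_map f y) = proj_range f y.
Proof.
move=> By; have [x Bx ex] := hat_surj (proj_range_in By).
exact: (@xgetPex _ 0 [set z | frakB z /\ hat f z = proj_range f y]
  (ex_intro _ x (conj Bx ex))).
Qed.

Lemma frakB_star_map_eq (y : cfm K (Xset aleph J)) x : frakB x -> frakB y ->
  hat f x = proj_range f y -> frakB_star_map f y = x.
Proof.
move=> Bx /frakB_star_mapP[Bs es] ex.
by apply: hat_inj => //; rewrite es.
Qed.

Lemma frakB_star_map_linear : linear_on_frakB (frakB_star_map (K := K) f).
Proof.
move=> k x y Bx By.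
have [[Bsx ex] [Bsy ey]] := (frakB_star_mapP Bx, frakB_star_mapP By).
apply: frakB_star_map_eq; [exact: Hsum_linear..|].
by rewrite hat_linear // proj_range_linear // ex ey.
Qed.

Lemma frakB_star_mapM (x y : cfm K (Xset aleph J)) : frakB x -> frakB y ->
  frakB_star_map f (x * y) = frakB_star_map f x * frakB_star_map f y.
Proof.
move=> Bx By; have [[Bsx ex] [Bsy ey]] := (frakB_star_mapP Bx, frakB_star_mapP By).
apply: frakB_star_map_eq; [exact: frakB_mul_in..|].
by rewrite hatM // proj_rangeM // ex ey.
Qed.

End Transport.

(** * Functoriality *)

Section Functoriality.
Variables (aleph : infinite_cardinal) (K : fieldType).
Implicit Types I J L : pos_obj aleph.

Lemma hat_id I (x : cfm K (Xset aleph I)) : frakB x -> hat (pos_id I) x = x.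
Proof.
move: x; apply: (eq_on_frakB (hat_linear _)) => [//|i x Hx].
rewrite (hat_H _ Hx); case: Hx => a _ <-; rewrite hat_comp_psi.
congr psi; apply: cfmP => u v.
have upper_id (k : upper i) : upper_map (pos_id I) k = k by exact: val_inj.
have pull_id w : @pullX aleph I I (pos_id I) i w = w.
  by apply: Xset_eq => k /=; rewrite upper_id.
by rewrite -[LHS]/(a (pullX u) (pullX v)) !pull_id.
Qed.

Lemma hat_pos_comp I J L (g : pos_hom J L) (f : pos_hom I J)
    (x : cfm K (Xset aleph I)) :
  frakB x -> hat (pos_comp g f) x = hat g (hat f x).
Proof.
move: x; apply: (eq_on_frakB (hat_linear _)) => [k x y Bx By|i x Hx].
  by rewrite !hat_linear //; exact: hat_frakB.
rewrite (hat_H f Hx) (hat_H g (hat_comp_H f Hx)) (hat_H _ Hx).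
case: Hx => a _ <-; rewrite !hat_comp_psi.
congr psi; apply: cfmP => u v.
have upper_comp (k : upper i) :
    upper_map (pos_comp g f) k = upper_map g (upper_map f k) by exact: val_inj.
have pull_comp w : @pullX aleph I L (pos_comp g f) i w =
    @pullX aleph I J f i (@pullX aleph J L g (f i) w).
  by apply: Xset_eq => k /=; rewrite upper_comp.
by rewrite -[LHS]/(a (pullX u) (pullX v)) !pull_comp.
Qed.

Lemma proj_range_id I (x : cfm K (Xset aleph I)) :
  frakB x -> proj_range (pos_id I) x = x.
Proof.
move: x; apply: (eq_on_frakB (proj_range_linear _)) => [//|i x Hx].
by rewrite (proj_range_H _ Hx) ifT //; apply/mem_set; exists i.
Qed.

(** The image of the composite lies in that of [g], so a component removed first would be removed
    anyway. *)
Lemma proj_range_comp I J L (g : pos_hom J L) (f : pos_hom I J)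
    (z : cfm K (Xset aleph L)) : frakB z ->
  proj_range (pos_comp g f) (proj_range g z) = proj_range (pos_comp g f) z.
Proof.
have pB y : frakB y -> frakB (proj_range g y).
  by move=> /(proj_range_in g)[s [hs ->]]; exists s; split=> // w /hs[l _ Hw]; exists l.
move: z; apply: eq_on_frakB => [k x y Bx By|k x y Bx By|l x Hx].
- by rewrite !proj_range_linear //; exact: pB.
- exact: proj_range_linear.
rewrite (proj_range_H g Hx); case: ifPn => // nl.
rewrite (linear_on_frakB0 (proj_range_linear _)) (proj_range_H _ Hx) ifN //.
by apply: contraNN nl => /set_mem[i _ <-]; apply/mem_set; exists (f i).
Qed.

(** [hat g] moves the component at [j] to [g j], and by injectivity of [g] this lies in the image of
    the composite exactly when [j] lies in that of [f]. *)
Lemma proj_range_hat I J L (g : pos_hom J L) (f : pos_hom I J)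
    (y : cfm K (Xset aleph J)) : frakB y ->
  proj_range (pos_comp g f) (hat g y) = hat g (proj_range f y).
Proof.
have pB x : frakB x -> frakB (proj_range f x).
  by move=> /(proj_range_in f)[s [hs ->]]; exists s; split=> // w /hs[l _ Hw]; exists l.
move: y; apply: eq_on_frakB => [k x y Bx By|k x y Bx By|j x Hx].
- by rewrite hat_linear // proj_range_linear //; exact: hat_frakB.
- by rewrite proj_range_linear // hat_linear //; exact: pB.
have Hgx := hat_comp_H g Hx.
rewrite (hat_H g Hx) (proj_range_H f Hx) (proj_range_H _ Hgx).
suff -> : (g j \in range (pos_comp g f)) = (j \in range f).
  case: ifP => _; first by rewrite (hat_H g Hx).
  by rewrite (linear_on_frakB0 (hat_linear g)).
apply/idP/idP => /set_mem[i _ e]; apply/mem_set; exists i => //.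
  exact: (@pos_inj _ _ _ g _ _ e).
by rewrite /= e.
Qed.

Lemma frakB_star_map_id I (x : cfm K (Xset aleph I)) :
  frakB x -> frakB_star_map (pos_id I) x = x.
Proof.
by move=> Bx; apply: frakB_star_map_eq; rewrite ?hat_id ?proj_range_id.
Qed.

Lemma frakB_star_map_comp I J L (g : pos_hom J L) (f : pos_hom I J)
    (z : cfm K (Xset aleph L)) : frakB z ->
  frakB_star_map (pos_comp g f) z = frakB_star_map f (frakB_star_map g z).
Proof.
move=> Bz; have [By ey] := frakB_star_mapP g Bz.
have [Bx ex] := frakB_star_mapP f By.
apply: frakB_star_map_eq => //.
(* Both sides are compared after applying [hat] of the composite: [hat f] turns the inner value into
   a projection, which is moved past [hat g] and absorbs the projection for [g]. *)
by rewrite hat_pos_comp // ex -proj_range_hat // ey proj_range_comp.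
Qed.

End Functoriality.

(** * Assembly of the two functors *)

Section Functors.
Variables (aleph : infinite_cardinal) (K : fieldType).

Section Restrict.
Variables (I J : pos_obj aleph) (F : cfm K (Xset aleph I) -> cfm K (Xset aleph J)).
Hypothesis F_in : forall x, frakB x -> frakB (F x).
Hypothesis F_linear : linear_on_frakB F.
Hypothesis F_mul : forall x y, frakB x -> frakB y -> F (x * y) = F x * F y.

Definition frakB_restrict (x : frakB_obj K I) : frakB_obj K J :=
  exist _ (F (frakB_incl x)) (mem_set (F_in (set_mem (valP (x : frakB_sort aleph K I))))).

Lemma frakB_restrict_linear : linear frakB_restrict.
Proof. by move=> k x y; apply: val_inj; apply: F_linear; exact: set_mem (valP _). Qed.

Lemma frakB_restrict_mul : {morph frakB_restrict : x y / ualg_mul x y}.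
Proof. by move=> x y; apply: val_inj; apply: F_mul; exact: set_mem (valP _). Qed.

Definition frakB_hom : alg_hom (frakB_obj K I) (frakB_obj K J) :=
  AlgHom frakB_restrict_linear frakB_restrict_mul.

End Restrict.

Definition frakB_fmap (I J : pos_obj aleph) (f : pos_hom I J) :
    alg_hom (frakB_obj K I) (frakB_obj K J) :=
  frakB_hom (@hat_frakB _ K _ _ f) (hat_linear f) (@hatM _ K _ _ f).

Definition frakB_star_fmap (I J : pos_obj aleph) (f : pos_hom I J) :
    alg_hom (frakB_obj K J) (frakB_obj K I) :=
  frakB_hom (fun y By => proj1 (@frakB_star_mapP _ K _ _ f y By))
    (frakB_star_map_linear f) (@frakB_star_mapM _ K _ _ f).

Definition frakB_functor : functor_on (C := Pos aleph) (D := Alg K) (frakB_obj K).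
Proof.
exists frakB_fmap => [I|I J L g f]; apply: alg_hom_eq => x; apply: val_inj.
  by apply: hat_id; exact: set_mem (valP _).
by apply: hat_pos_comp; exact: set_mem (valP _).
Defined.

Definition frakB_star_functor :
  functor_on (C := op (Pos aleph)) (D := Alg K) (frakB_obj K).
Proof.
(* Arrows are reversed: here [f] is a morphism from [I] to [J] and [g] one from [J] to [L]. *)
exists (fun I J f => frakB_star_fmap f) => [I|L J I f g]; apply: alg_hom_eq => x; apply: val_inj.
  by apply: frakB_star_map_id; exact: set_mem (valP _).
by apply: frakB_star_map_comp; exact: set_mem (valP _).
Defined.

End Functors.

Theorem proposition7p5 (aleph : infinite_cardinal) (K : fieldType) :
  (exists F : functor_on (C := Pos aleph) (D := Alg K) (frakB_obj K),
     forall (I J : pos_obj aleph) (f : pos_hom I J) (x : frakB_obj K I),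
       frakB_incl (fmap F f x) = frakB_map f (frakB_incl x)) /\
  (exists G : functor_on (C := op (Pos aleph)) (D := Alg K) (frakB_obj K),
     forall (I J : pos_obj aleph) (f : pos_hom I J) (y : frakB_obj K J),
       frakB_incl (fmap G f y) = frakB_star_map f (frakB_incl y)).
Proof.
(* The required equations hold by definition, as both functors act by restrictions of the given
   maps. *)
by split; [exists (frakB_functor aleph K)|exists (frakB_star_functor aleph K)].
Qed.
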